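(* Let $X\subseteq\mathbb{P}^n$ be a standard determinantal scheme of codimension $2$ whose degree matrix $A\in\mathbb{Z}^{t\times(t+1)}$ has no zero entries. Then $h^A$ is a pure O-sequence if and only if all rows of $A$ are equal.
   Context: Let $\Bbbk$ be an infinite field and $S=\Bbbk[x_0,\dots,x_n]$ with the standard grading. For integers $t,c\ge1$, a $t\times(t+c-1)$ matrix $M=(f_{i,j})$ with entries in $S$ is homogeneous if there are integers $a_1,\dots,a_t$, $b_1,\dots,b_{t+c-1}$ such that each $f_{i,j}$ is zero or a form of degree $b_j-a_i$, with $f_{i,j}=0$ whenever $b_j-a_i\le 0$. Let $I_{\max}(M)$ be the ideal generated by the maximal ($t\times t$) minors of $M$. An ideal $I\subseteq S$ is standard determinantal if $I=I_{\max}(M)$ for such an $M$ and $I$ has height $c$; the projective scheme it defines is called a standard determinantal scheme of codimension $c$. Its degree matrix is $A=(a_{i,j})\in\mathbb{Z}^{t\times(t+c-1)}$ with $a_{i,j}=b_j-a_i$, where it is always assumed that $a_1\le\cdots\le a_t$ and $b_1\le\cdots\le b_{t+c-1}$ (so the entries of $A$ weakly increase from left to right and from bottom to top), and that $a_{i,i}>0$ for all $i$. Writing the Hilbert series of $S/I$ as $\mathrm{hp}(z)/(1-z)^d$ with $d=\dim S/I$, the numerator $\mathrm{hp}(z)=1+h_1z+\cdots+h_sz^s$ ($h_s\ne0$) is the $h$-polynomial and $(1,h_1,\dots,h_s)$ is the $h$-vector. For a standard determinantal ideal it depends only on $A$, and is denoted $h^A$. An order ideal is a finite set $\Gamma$ of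 monomials (in finitely many variables) closed under division; it is pure if all its maximal elements with respect to divisibility have the same degree. Its $f$-vector is $(f_0,\dots,f_s)$ with $f_i$ the number of monomials of degree $i$ in $\Gamma$. A vector is a pure O-sequence if it is the $f$-vector of a pure order ideal (equivalently, the Hilbert function of an artinian level algebra that is a quotient of a polynomial ring by a monomial ideal). *)

(* Defs.v *)
From mathcomp Require Export all_boot all_order all_algebra.
From mathcomp Require Export ring_quotient.
From mathcomp Require Export finmap.
From mathcomp Require Export mpoly.

Set Implicit Arguments.
Unset Strict Implicit.
Unset Printing Implicit Defensive.

Import GRing.Theory Num.Theory.

Local Open Scope ring_scope.

Definition infinite_type (T : eqType) : Prop :=
  forall s : seq T, exists x : T, x \notin s.

(* Ideals whose membership need not be decidable are Prop-valued predicates;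
   prime ideals are the boolean ones of ring_quotient. *)

Section Ideals.
Variable R : comNzRingType.
Implicit Types (P Q : prime_idealr R) (I : R -> Prop).

Definition ideal_gen (G : R -> Prop) (x : R) : Prop :=
  exists (m : nat) (c g : 'I_m -> R),
    (forall i, G (g i)) /\ x = \sum_(i < m) c i * g i.

Definition prime_contains I P : Prop := forall x, I x -> x \in P.

Definition prime_lt P Q : Prop :=
  {subset P <= Q} /\ (exists2 x, x \in Q & x \notin P).

(* C 0 < C 1 < ... < C m, a chain of length m. *)
Definition prime_chain (m : nat) (C : 'I_m.+1 -> prime_idealr R) : Prop :=
  forall i j : 'I_m.+1, (i < j)%N -> prime_lt (C i) (C j).

Definition prime_height_ge P (m : nat) : Prop :=
  exists C : 'I_m.+1 -> prime_idealr R, prime_chain C /\ C ord_max =i P.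

(* The height of I is the infimum of the heights of the primes containing I. *)
Definition height_ge I (m : nat) : Prop :=
  forall P, prime_contains I P -> prime_height_ge P m.

Definition has_height I (m : nat) : Prop :=
  height_ge I m /\ ~ height_ge I m.+1.

(* Krull dimension of R / I: the primes of R / I are the primes containing I. *)
Definition quotient_dim_ge I (m : nat) : Prop :=
  exists C : 'I_m.+1 -> prime_idealr R,
    prime_chain C /\ (forall i, prime_contains I (C i)).

Definition has_quotient_dim I (d : nat) : Prop :=
  quotient_dim_ge I d /\ ~ quotient_dim_ge I d.+1.

End Ideals.

Section HilbertSeries.
Variables (k : fieldType) (n : nat).
Local Notation S := {mpoly k[n]}.
Implicit Type I : S -> Prop.

(* dim_k (S / I)_i = r, for I homogeneous: the classes of e_0, ..., e_(r-1)
   form a basis of S_i modulo I. *)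
Definition has_hilbert_value I (i r : nat) : Prop :=
  exists e : 'I_r -> S,
    (forall j, e j \is i.-homog) /\
    (forall p : S, p \is i.-homog ->
       exists! c : 'rV[k]_r, I (p - \sum_(j < r) c 0 j *: e j)).

(* \sum_i H_i z^i = hp / (1 - z)^d with d = dim S / I, stated by comparing the
   coefficients of hp and of (1 - z)^d * \sum_i H_i z^i. *)
Definition is_h_polynomial I (hp : {poly int}) : Prop :=
  exists (H : nat -> nat) (d : nat),
    [/\ forall i, has_hilbert_value I i (H i),
        has_quotient_dim I d
      & forall i, hp`_i = \sum_(j < i.+1) ((1 - 'X) ^+ d)`_j * (H (i - j)%N)%:Z].

Definition is_h_vector I (h : seq int) : Prop :=
  exists2 hp : {poly int}, is_h_polynomial I hp & h = polyseq hp.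

End HilbertSeries.

Section StandardDeterminantal.
Variables (k : fieldType) (n : nat).
Local Notation S := {mpoly k[n.+1]}.

Definition maximal_minor (t m : nat) (M : 'M[S]_(t, m)) (p : S) : Prop :=
  exists2 f : 'I_t -> 'I_m,
    {homo f : i j / (i < j)%N} & p = \det (colsub f M).

Definition ideal_max (t m : nat) (M : 'M[S]_(t, m)) : S -> Prop :=
  ideal_gen (maximal_minor M).

Definition homogeneous_of_degrees (t m : nat) (M : 'M[S]_(t, m))
    (a : 'I_t -> int) (b : 'I_m -> int) : Prop :=
  forall i j,
    (M i j = 0 \/ exists2 d : nat, b j - a i = d%:Z & M i j \is d.-homog) /\
    (b j - a i <= 0 -> M i j = 0).

(* I is standard determinantal of codimension c, with degree matrix A.
   As c >= 1, t + c.-1 is t + c - 1. *)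
Definition standard_determinantal (t c : nat) (A : 'M[int]_(t, t + c.-1))
    (I : S -> Prop) : Prop :=
  [/\ (0 < t)%N, (0 < c)%N, has_height I c
    & exists (M : 'M[S]_(t, t + c.-1)) (a : 'I_t -> int)
             (b : 'I_(t + c.-1) -> int),
      [/\ homogeneous_of_degrees M a b,
          forall p, I p <-> ideal_max M p,
          A = \matrix_(i, j) (b j - a i),
          {homo a : i j / (i <= j)%N >-> i <= j} /\
          {homo b : i j / (i <= j)%N >-> i <= j}
        & forall i : 'I_t, 0 < A i (lshift c.-1 i)]].

End StandardDeterminantal.

(* A monomial in r variables is an exponent vector 'X_{1..r}; divisibility is
   the pointwise order (_ <= _)%MM. *)
Section OrderIdeals.
Variable r : nat.
Implicit Type G : {fset 'X_{1..r}}.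

Definition order_ideal G : Prop :=
  forall m m' : 'X_{1..r}, m \in G -> (m' <= m)%MM -> m' \in G.

Definition maximal_in G (m : 'X_{1..r}) : Prop :=
  m \in G /\ (forall m', m' \in G -> (m <= m')%MM -> m' = m).

Definition pure G : Prop :=
  forall m m', maximal_in G m -> maximal_in G m' -> mdeg m = mdeg m'.

Definition f_vector G : seq nat :=
  mkseq (fun i => count (fun m => mdeg m == i) (enum_fset G))
        (\max_(m <- enum_fset G) mdeg m).+1.

End OrderIdeals.

Definition pure_O_sequence (v : seq int) : Prop :=
  exists (r : nat) (G : {fset 'X_{1..r}}),
    [/\ G != fset0, order_ideal G, pure G & v = [seq Posz x | x <- f_vector G]].

(* Main.v *)
(* Let a_i, b_j be the degrees of the rows and columns of M. Since I has height 2
   and k[x_0, ..., x_n] is factorial, the maximal minors have no common factor, so by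
   Hilbert-Burch the rows of M generate the syzygies of the minors freely. With E_j the
   degrees of the minors and C_i those of the syzygies this gives
     (1 - z)^2 h(z) = 1 - sum_j z^(E_j) + sum_i z^(C_i),   C_i - E_j = b_j - a_i,
   where no exponent E_j equals an exponent C_i because A has no zero entry.
   If h is the f-vector of a pure order ideal with top degree s, then (unless t = 1)
   there are two variables, and there the coefficients of (1 - z)^2 h(z) in the degrees
   1, ..., s + 1 are nonpositive, so all C_i equal s + 2 and all a_i are equal.
   Conversely h is always the f-vector of the set of monomials in x and y divisible by
   no x^(p_0 + ... + p_(j-1)) y^(q_j + ... + q_(t-1)), where p_i = b_i - a_i and
   q_i = b_(i+1) - a_i; its maximal elements have degrees C_i - 2, so it is pure when all
   a_i are equal. *)
From HB Require Import structures.
Require Import Defs.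
From mathcomp Require Import all_boot all_order all_algebra mpoly.
From mathcomp Require Import perm zify ring.
From Stdlib Require Import Classical ClassicalEpsilon.
Local Open Scope ring_scope.

Set Implicit Arguments.
Unset Strict Implicit.
Unset Printing Implicit Defensive.

Import Order.TTheory GRing.Theory Num.Theory.

(** * Unique factorization in polynomial rings *)

(** The h-polynomial is defined through the Krull dimension d of S/I, so d has to be found. Chains
    of primes supply only d <= n - 1. The resolution then gives (1 - z)^(n+1-d) hp = (1 - z)^2 h
    with h an explicit sum of rectangles, and h(1) > 0 forbids any further factor 1 - z; hence d = n
    - 1 and hp = h. For t >= 2 all E_j and C_i are at least 2, so h starts with 1 + 2z, which is
    where the two variables come from. Purity acts locally: the coefficient of (1 - z)^2 h in degree
    i + 2 is a sum over unit squares of exponents plus boundary terms, and a square could contribute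
    positively only if its lower corner, of degree i < s, were a maximal monomial. Each C_i carries
    a positive coefficient, since no E_j cancels it, so C_i > s + 1; and (1 - z)^2 h has degree s +
    2. For t = 1 there is only one row to compare. *)

Section Divisibility.
Variable R : idomainType.
Implicit Types a b c p s u : R.

Definition divides a b := exists c, b = c * a.

Definition prime_elt p :=
  [/\ p != 0, p \isn't a GRing.unit
    & forall a b, divides p (a * b) -> divides p a \/ divides p b].

Definition factorization s u (ps : seq R) :=
  [/\ u \is a GRing.unit, forall p, p \in ps -> prime_elt p
    & s = u * \prod_(p <- ps) p].

Lemma divides_mull p a b : divides p b -> divides p (a * b).
Proof. by case=> c ->; exists (a * c); rewrite mulrA. Qed.

Lemma divides_mulr p a b : divides p a -> divides p (a * b).
Proof. by rewrite mulrC; apply: divides_mull. Qed.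

Lemma divides0 p : divides p 0.
Proof. by exists 0; rewrite mul0r. Qed.

Lemma divides_refl p : divides p p.
Proof. by exists 1; rewrite mul1r. Qed.

Lemma dividesD p a b : divides p a -> divides p b -> divides p (a + b).
Proof. by case=> c -> [d ->]; exists (c + d); rewrite mulrDl. Qed.

Lemma dividesN p a : divides p a -> divides p (- a).
Proof. by case=> c ->; exists (- c); rewrite mulNr. Qed.

Lemma divides_pmul2 p a b : p != 0 -> divides (p * a) (p * b) -> divides a b.
Proof.
move=> p0 [c e]; exists c; apply: (mulfI p0).
by rewrite e; ring.
Qed.

Lemma prime_elt_not_unit p u : prime_elt p -> u \is a GRing.unit -> ~ divides p u.
Proof.
move=> [_ /negP pU _] uU [c e]; apply: pU.
by move: uU; rewrite e unitrM => /andP[].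
Qed.

Lemma prime_elt_prod p u (ps : seq R) : prime_elt p ->
  u \is a GRing.unit ->
  divides p (u * \prod_(q <- ps) q) -> exists2 q, q \in ps & divides p q.
Proof.
move=> pp uU; elim: ps => [|q ps IH].
  by rewrite big_nil mulr1 => /(prime_elt_not_unit pp uU).
rewrite big_cons mulrCA => d; case: pp => _ _ /(_ _ _ d) [dq|/IH[r rps dr]].
  by exists q; rewrite ?mem_head.
by exists r; rewrite // in_cons rps orbT.
Qed.

Lemma prime_elt_assoc p q : prime_elt p -> prime_elt q -> divides p q ->
  exists2 c, c \is a GRing.unit & q = c * p.
Proof.
move=> [p0 pU _] [q0 qU qP] [c e]; exists c => //.
have [[d ec]|[d ep]] : divides q c \/ divides q p.
- by apply: qP; rewrite -e; apply: divides_refl.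
- case/negP: pU; apply/unitrPr; exists d; apply: (mulfI q0).
  by rewrite {2}e ec mulr1; ring.
- apply/unitrPr; exists d; apply: (mulfI q0); rewrite {2}e ep mulr1; ring.
Qed.

End Divisibility.

(** The factors are prime rather than merely irreducible, so existence alone characterizes factorial
    domains: uniqueness is automatic. *)
Definition factorial_domain (R : idomainType) :=
  forall s : R, s != 0 -> exists u ps, factorization s u ps.

(* Some prime occurs in s more often than in u; it divides every a with s | a u. *)
Lemma prime_of_proper_colon (R : idomainType) (s u : R) :
  factorial_domain R -> s != 0 -> ~ divides s u ->
  exists2 p, prime_elt p & forall a, divides s (a * u) -> divides p a.
Proof.
move=> F /F [v [ps [vU ps_p ->]]]; elim: ps u ps_p => [|p ps IH] u ps_p.
  case; exists (u / v); rewrite big_nil mulr1 divrK //.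
have pp : prime_elt p by apply: ps_p; rewrite mem_head.
have p0 : p != 0 by case: pp.
rewrite big_cons mulrCA; case: (classic (divides p u)) => [[u' ->]|pu] su.
  have [] := IH u' _ _.
  - by move=> q qps; apply: ps_p; rewrite in_cons qps orbT.
  - case=> c e; apply: su; exists c; rewrite e; ring.
  move=> q qp qd; exists q => // a ad; apply: qd; apply: (divides_pmul2 p0).
  by move: ad; congr divides; ring.
exists p => // a [c e].
have : divides p (a * u).
  by rewrite e; apply: divides_mull; apply: divides_mulr; apply: divides_refl.
by case: pp => _ _ P /P [].
Qed.

Lemma factorial_domain_iso (A B : idomainType) (f : {rmorphism A -> B})
    (g : {rmorphism B -> A}) :
  cancel f g -> cancel g f -> factorial_domain B -> factorial_domain A.
Proof.
move=> fK gK FB s s0.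
have [u [ps [uU ps_p e]]] : exists u ps, factorization (f s) u ps.
  by apply: FB; rewrite -(rmorph0 f) (can_eq fK).
exists (g u), (map g ps); split; first by rewrite rmorph_unit.
  move=> _ /mapP[p /ps_p [p0 pU pP] ->]; split.
  - by rewrite -(rmorph0 g) (can_eq gK).
  - by apply: contra pU => /(rmorph_unit f); rewrite gK.
  move=> a b [c ec].
  have [] : divides p (f a) \/ divides p (f b).
    by apply: pP; exists (f c); rewrite -rmorphM ec rmorphM gK.
  - by case=> d ed; left; exists (g d); rewrite -rmorphM -ed fK.
  - by case=> d ed; right; exists (g d); rewrite -rmorphM -ed fK.
by rewrite big_map -rmorph_prod -rmorphM -e fK.
Qed.

(** * Gauss's lemma and factoriality of R[X] *)

Section Gauss.
Variable R : idomainType.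
Implicit Types (p c : R) (f g q : {poly R}).

Lemma divides_polyC p f : divides p%:P f <-> forall i, divides p f`_i.
Proof.
split=> [[g ->] i|]; first by exists g`_i; rewrite coefMC.
elim/poly_ind: f => [_|f c IH H]; first exact: divides0.
have /IH [g ->] : forall i, divides p f`_i.
  by move=> i; move: (H i.+1); rewrite coefD coefMX coefC /= addr0.
have [d e] : divides p c by move: (H 0%N); rewrite coefD coefMX coefC /= add0r.
exists (g * 'X + d%:P); rewrite mulrDl e polyCM; ring.
Qed.

(* Gauss's lemma: if p divides f g, it divides a leading coefficient, and the
   corresponding leading term can be dropped. *)
Lemma prime_elt_polyC p : prime_elt p -> prime_elt p%:P.
Proof.
move=> [p0 pU pP]; split; first by rewrite polyC_eq0.
  by rewrite poly_unitE coefC /= (negbTE pU) andbF.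
move=> f g; have [n] := ubnP (size f + size g).
elim: n f g => // n IH f g le_n d.
have [->|f0] := eqVneq f 0; first by left; apply: divides0.
have [->|g0] := eqVneq g 0; first by right; apply: divides0.
have tail q : q != 0 -> divides p (lead_coef q) ->
    exists q', [/\ (size q' < size q)%N, divides p%:P (q - q')
                 & divides p%:P q' -> divides p%:P q].
  move=> q0 [c e]; pose m := lead_coef q *: 'X^((size q).-1) : {poly R}.
  have dm : divides p%:P m.
    exists (c *: 'X^((size q).-1)).
    by rewrite /m [RHS]mulrC mul_polyC scalerA e mulrC.
  exists (q - m); split.
  - have := polySpred q0; move: (size q).-1 => l el.
    rewrite el ltnS; apply/leq_sizeP => j lej.
    rewrite coefB coefZ coefXn lead_coefE el /=; case: eqP => [->|/eqP nj].
      by rewrite mulr1 subrr.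
    by rewrite mulr0 subr0 nth_default // el ltn_neqAle eq_sym nj.
  - by rewrite opprB addrC subrK.
  - by move=> d'; rewrite -[q](subrK m); apply: dividesD.
have /pP [dl|dl] : divides p (lead_coef f * lead_coef g).
  by rewrite -lead_coefM lead_coefE; move/divides_polyC: d.
- have [f' [ltf df fP]] := tail f f0 dl.
  have d' : divides p%:P (f' * g).
    have -> : f' * g = f * g + - ((f - f') * g) by ring.
    by apply: (dividesD d); apply: dividesN; apply: divides_mulr.
  by have [|/fP|] := IH f' g _ d'; [lia | left | right].
- have [g' [ltg dg gP]] := tail g g0 dl.
  have d' : divides p%:P (f * g').
    have -> : f * g' = f * g + - (f * (g - g')) by ring.
    by apply: (dividesD d); apply: dividesN; apply: divides_mull.
  by have [||/gP] := IH f g' _ d'; [lia | left | right].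
Qed.

(** Content 1, expressed by primes so that no gcd of coefficients has to be chosen. *)
Definition primitive f := forall p, prime_elt p -> ~ divides p%:P f.

Hypothesis R_fact : factorial_domain R.

(** Any prime constant dividing [f] divides its leading coefficient, so pulling primes out stops
    after at most as many steps as that coefficient has prime factors. *)
Lemma primitive_part f : f != 0 ->
  exists (c : R) q, [/\ c != 0, f = c%:P * q & primitive q].
Proof.
move=> f0; have [u [ps]] : exists u ps, factorization (lead_coef f) u ps.
  by apply: R_fact; rewrite lead_coef_eq0.
have [n] := ubnP (size ps); elim: n u ps f f0 => // n IH u ps f f0 le_n [uU ps_p e].
case: (classic (primitive f)) => [fP|].
  by exists 1, f; rewrite oner_eq0 polyC1 mul1r.
move=> nP; have [p nQ] := not_all_ex_not _ _ nP.
have [pp nD] := imply_to_and _ _ nQ; have [g eg] := NNPP _ nD.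
have p0 : p != 0 by case: pp.
have g0 : g != 0 by apply: contraNneq f0 => g0; rewrite eg g0 mul0r.
have el : lead_coef f = lead_coef g * p by rewrite eg lead_coefM lead_coefC.
have [q qps dq] : exists2 q, q \in ps & divides p q.
  by apply: (prime_elt_prod pp uU); rewrite -e; exists (lead_coef g).
have [c cU eq] := prime_elt_assoc pp (ps_p _ qps) dq.
have ge : factorization (lead_coef g) (u * c) (rem q ps).
  split; first by rewrite unitrM uU.
    by move=> r /mem_rem; apply: ps_p.
  apply: (mulIf p0); rewrite -el e (perm_big _ (perm_to_rem qps)) big_cons /= eq; ring.
have lt_n : (size (rem q ps) < n)%N.
  by rewrite size_rem //; case: (ps) qps le_n.
have [d [h [d0 eh hP]]] := IH _ _ g g0 lt_n ge.
exists (p * d), h; split=> //; first by rewrite mulf_neq0.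
by rewrite eg eh polyCM; ring.
Qed.

(** Turns divisibility by [q] over the fraction field into divisibility over [R]: each prime factor
    of [c] divides g q, hence g by Gauss's lemma, and is cancelled in turn. *)
Lemma primitive_cancel q c f g : primitive q -> c != 0 ->
  c%:P * f = g * q -> exists2 h, f = h * q & g = c%:P * h.
Proof.
move=> qP c0 e; suff [h eh] : divides c%:P g.
  exists h; last by rewrite eh mulrC.
  have c0' : c%:P != 0 by rewrite polyC_eq0.
  by apply: (mulfI c0'); rewrite e eh; ring.
have [u [ps [uU ps_p ec]]] := R_fact c0.
move: e; rewrite ec {ec c0 c}; elim: ps g ps_p => [|p ps IH] g ps_p e.
  by rewrite big_nil mulr1; exists (u^-1%:P * g); rewrite mulrAC -polyCM mulVr ?mul1r.
have pp : prime_elt p by apply: ps_p; rewrite mem_head.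
have p0 : p%:P != 0 by rewrite polyC_eq0; case: pp.
have [_ _ pP] := prime_elt_polyC pp.
have [[g' eg]|/(qP _ pp)//] : divides p%:P g \/ divides p%:P q.
  apply: pP; rewrite -e big_cons mulrCA polyCM.
  by do 2!apply: divides_mulr; apply: divides_refl.
have [] := IH g'.
- by move=> r rps; apply: ps_p; rewrite in_cons rps orbT.
- apply: (mulfI p0); move: e; rewrite eg big_cons !polyCM => e.
  transitivity (u%:P * (p%:P * (\prod_(j <- ps) j)%:P) * f); first by ring.
  by rewrite e; ring.
by move=> h e'; exists h; rewrite eg e' big_cons !polyCM; ring.
Qed.

Lemma factorization_mul (A : idomainType) (a b : A) :
  (exists u ps, factorization a u ps) -> (exists u ps, factorization b u ps) ->
  exists u ps, factorization (a * b) u ps.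
Proof.
move=> [u [ps [uU psP ->]]] [v [qs [vU qsP ->]]]; exists (u * v), (ps ++ qs).
split; first by rewrite unitrM uU.
  by move=> p; rewrite mem_cat => /orP[/psP|/qsP].
by rewrite big_cat /=; ring.
Qed.

Lemma primitive_factorization q : primitive q -> q != 0 ->
  exists u ps, factorization q u ps.
Proof.
have [n] := ubnP (size q); elim: n q => // n IH q le_n qP q0.
have [s1|s1] := leqP (size q) 1.
  have [c ec] : exists c, q = c%:P by exists q`_0; apply: size1_polyC.
  have c0 : c != 0 by rewrite -polyC_eq0 -ec.
  exists q, [::]; split=> //; last by rewrite big_nil mulr1.
  have [u [[|p ps] [uU ps_p e]]] := R_fact c0.
    by rewrite ec poly_unitE coefC size_polyC c0 /= e big_nil mulr1.
  have /qP[] : prime_elt p by apply: ps_p; rewrite mem_head.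
  exists (u * \prod_(p <- ps) p)%:P; rewrite ec e big_cons -polyCM.
  by congr (_ %:P); ring.
(* [dvdp] is divisibility up to a nonzero constant, that is, over the fraction field; the primitive
   part of such an [r] divides [q] in R[X] itself. *)
case: (classic (exists2 r : {poly R}, (1 < size r < size q)%N
    & Pdiv.Idomain.dvdp r q)) => [[r]|nex].
  move=> /andP[r1 rq] /Pdiv.WeakIdomain.dvdpP [[c d] /= c0].
  rewrite -mul_polyC => e.
  have r0 : r != 0 by rewrite -size_poly_gt0; lia.
  have [a [r' [a0 er r'P]]] := primitive_part r0.
  have sr : size r' = size r by rewrite er mul_polyC size_scale.
  have [h eh _] : exists2 h, q = h * r' & d * a%:P = c%:P * h.
    by apply: primitive_cancel => //; rewrite e er mulrA.
  have h0 : h != 0 by apply: contraNneq q0 => h0; rewrite eh h0 mul0r.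
  have r'0 : r' != 0 by rewrite -size_poly_gt0 sr; lia.
  have sq : (size q).+1 = (size h + size r')%N.
    by rewrite eh size_mul // prednK // addn_gt0 lt0n size_poly_eq0 h0.
  rewrite eh; apply: factorization_mul; apply: IH => //; try lia.
  by move=> p pp [k ek]; apply: (qP _ pp); exists (k * r'); rewrite eh ek; ring.
(* Irreducible over the fraction field, [q] is prime there: its gcd with [f] is associated to [q] or
   constant. [cancel] brings the conclusion back to R[X]. *)
exists 1, [:: q]; split; rewrite ?unitr1 ?big_seq1 ?mul1r // => _ /[!inE] /eqP->.
split=> //; first by rewrite poly_unitE negb_and eqn_leq leqNgt s1.
move=> f g [h e].
have cancel f1 : Pdiv.Idomain.dvdp q f1 -> divides q f1.
  case/Pdiv.WeakIdomain.dvdpP => [[c d] /= c0]; rewrite -mul_polyC => ed.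
  by have [k ->] := primitive_cancel qP c0 ed; exists k.
have qfg : Pdiv.Idomain.dvdp q (f * g) by rewrite e Pdiv.Idomain.dvdp_mull.
have gq := Pdiv.Idomain.dvdp_gcdl q f.
have [gt1|le1] := ltnP 1 (size (Pdiv.Idomain.gcdp q f)).
  left; apply: cancel; apply: Pdiv.Idomain.dvdp_trans (Pdiv.Idomain.dvdp_gcdr q f).
  have := Pdiv.Idomain.dvdp_size_eqp gq.
  have := Pdiv.Idomain.leq_gcdpl f q0; rewrite leq_eqVlt => /orP[-> /esym|lt].
    by rewrite Pdiv.Idomain.eqp_sym => /Pdiv.Idomain.eqp_dvdl ->.
  by case: nex; exists (Pdiv.Idomain.gcdp q f); rewrite ?gt1.
right; apply: cancel; rewrite Pdiv.Idomain.Gauss_dvdpr // in qfg.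
rewrite Pdiv.Idomain.coprimep_def eqn_leq le1 size_poly_gt0.
by rewrite Pdiv.Idomain.gcdp_eq0 (negbTE q0).
Qed.

Lemma factorial_domain_poly : factorial_domain {poly R}.
Proof.
move=> f f0; have [c [q [c0 ef qP]]] := primitive_part f0.
rewrite ef; apply: factorization_mul; last first.
  by apply: primitive_factorization => //; apply: contraNneq f0 => q0; rewrite ef q0 mulr0.
have [u [ps [uU ps_p ->]]] := R_fact c0; exists u%:P, (map polyC ps); split.
- have u0 : u != 0 by apply: contraTneq uU => ->; rewrite unitr0.
  by rewrite poly_unitE coefC size_polyC u0 eqxx.
- by move=> _ /mapP[p /ps_p pp ->]; apply: prime_elt_polyC.
- by rewrite polyCM rmorph_prod big_map.
Qed.

End Gauss.

(** * Factoriality of polynomial rings in several variables, by induction on their number *)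

Section FactorialMpoly.
Variable k : fieldType.

(** The inverse of [muni], which reads a polynomial in n + 1 variables as univariate in the last
    one. *)
Definition mmulti_horner n (p : {poly {mpoly k[n]}}) : {mpoly k[n.+1]} :=
  (map_poly (@mwiden n k) p).['X_ord_max].

Lemma muni_mwiden n (p : {mpoly k[n]}) : muni (mwiden p) = p%:P.
Proof.
elim/mpolyind: p => [|c m p _ _ IH]; first by rewrite mwiden0 muni0.
rewrite mwidenD muniD polyCD IH mwidenZ muniZ mwidenX; congr (_ + _).
rewrite muniE msuppX big_seq1 mcoeffX eqxx scale1r mnmwiden_ordmax expr0 alg_polyC.
rewrite -mul_polyC -polyCM mul_mpolyC; congr (_ *: 'X_[_])%:P.
by apply/mnmP => i; rewrite mnmE mnmwiden_widen.
Qed.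

Lemma mmulti_hornerK n : cancel (@mmulti_horner n) (@muni n k).
Proof.
elim/poly_ind => [|p c IH]; first by rewrite /mmulti_horner rmorph0 horner0 muni0.
rewrite /mmulti_horner rmorphD rmorphM /= map_polyX map_polyC /= hornerMXaddC.
rewrite muniD muniM -/(mmulti_horner p) IH muni_mwiden; congr (_ * _ + _).
rewrite muniE msuppX big_seq1 mcoeffX eqxx scale1r mnmE eqxx expr1.
rewrite (_ : [multinom _ | i < n] = 0%MM) ?mpolyX0 ?scale1r //.
apply/mnmP => i; rewrite !mnmE; case: eqP => // /(congr1 val) /= e.
by move: (ltn_ord i); rewrite -e ltnn.
Qed.

Lemma muniK n : cancel (@muni n k) (@mmulti_horner n).
Proof.
move=> p.
have D : {morph (@mmulti_horner n) : x y / x + y}.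
  by move=> x y; rewrite /mmulti_horner rmorphD hornerD.
elim/mpolyind: p => [|c m p _ _ IH].
  by rewrite muni0 /mmulti_horner rmorph0 horner0.
rewrite muniD D; apply: (congr2 +%R); last exact: IH.
rewrite muniZ.
rewrite muniE msuppX big_seq1 mcoeffX eqxx scale1r /mmulti_horner.
rewrite -mul_polyC -[_ *: 'X^_]mul_polyC !rmorphM /= !map_polyC map_polyXn /=.
rewrite !hornerCM hornerXn mwidenC mwidenX mul_mpolyC; congr (_ *: _).
rewrite mpolyXn -mpolyXD; congr 'X_[_]; apply/mnmP => i.
rewrite mnmDE mulmnE mnm1E.
case: (unliftP ord_max i) => [j ->|->].
  have -> : lift ord_max j = widen_ord (leqnSn n) j.
    by apply: val_inj; rewrite /= /bump leqNgt ltn_ord.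
  rewrite mnmwiden_widen mnmE; case: eqP => [/(congr1 val) /= e|_]; last by lia.
  by move: (ltn_ord j); rewrite -e ltnn.
by rewrite mnmwiden_ordmax eqxx; lia.
Qed.

Lemma mmulti_horner_is_additive n : GRing.additive (@mmulti_horner n).
Proof. by move=> p q; rewrite /mmulti_horner rmorphB hornerD hornerN. Qed.

Lemma mmulti_horner_is_multiplicative n : GRing.multiplicative (@mmulti_horner n).
Proof.
split=> [p q|]; first by rewrite /mmulti_horner rmorphM hornerM.
by rewrite /mmulti_horner rmorph1 hornerC.
Qed.

HB.instance Definition _ n :=
  GRing.isAdditive.Build {poly {mpoly k[n]}} {mpoly k[n.+1]} (@mmulti_horner n)
    (@mmulti_horner_is_additive n).
HB.instance Definition _ n :=
  GRing.isMultiplicative.Build {poly {mpoly k[n]}} {mpoly k[n.+1]} (@mmulti_horner n)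
    (@mmulti_horner_is_multiplicative n).

Lemma factorial_domain_mpoly n : factorial_domain {mpoly k[n]}.
Proof.
elim: n => [|n IH]; last first.
  exact: factorial_domain_iso (@muniK n) (@mmulti_hornerK n) (factorial_domain_poly IH).
move=> s s0; exists s, [::]; split; rewrite ?big_nil ?mulr1 //.
have es : s = (s@_0)%:MP.
  apply/mpolyP => m; rewrite mcoeffC.
  have -> : m = 0%MM by apply/mnmP => -[].
  by rewrite eqxx mulr1.
have c0 : s@_0 != 0 by apply: contraNneq s0 => e; rewrite es e.
by rewrite es; apply: (rmorph_unit (@mpolyC 0 k)); rewrite unitfE.
Qed.

End FactorialMpoly.

(** * Ideals of height two and the Hilbert-Burch theorem *)

(** Prime ideals are boolean predicates, whereas divisibility by a prime is a proposition;
    informative excluded middle bridges the two. *)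
Lemma prime_idealr_of_predicate (R : comNzRingType) (D : R -> Prop) :
  D 0 -> ~ D 1 -> (forall a u v, D u -> D v -> D (a * u + v)) ->
  (forall u v, D (u * v) -> D u \/ D v) ->
  exists P : prime_idealr R, forall x, x \in P <-> D x.
Proof.
move=> D0 D1 Dlin DM.
pose S : R -> bool := fun x => if excluded_middle_informative (D x) then true else false.
have SP x : x \in S <-> D x.
  by rewrite unfold_in /S; case: excluded_middle_informative.
have idS : idealr_closed S.
  split; first exact/SP.
    by apply/negP => /SP.
  by move=> a u v /SP Du /SP Dv; apply/SP/Dlin.
have prS : prime_idealr_closed S.
  by move=> u v /SP /DM [Du|Dv]; apply/orP; [left | right]; apply/SP.
pose P : prime_idealr R :=
  HB.pack S (isIdealr.Build R S idS) (isPrimeIdealrClosed.Build R S prS).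
by exists P.
Qed.

Section HeightTwo.
Variables (k : fieldType) (n : nat).
Local Notation S := {mpoly k[n]}.
Implicit Type I : S -> Prop.

(** Otherwise the zero ideal would be a prime containing [I], and nothing lies strictly below it. *)
Lemma height_ge2_nonzero I : height_ge I 2 -> exists2 x, I x & x != 0.
Proof.
move=> htI; apply: NNPP => nex.
have [||||P PP] := @prime_idealr_of_predicate S (fun x => x = 0).
- by [].
- by apply/eqP; rewrite oner_eq0.
- by move=> a u v -> ->; rewrite mulr0 addr0.
- by move=> u v /eqP; rewrite mulf_eq0 => /orP[] /eqP; [left | right].
have [|C [chC CP]] := htI P.
  move=> x Ix; apply/PP; apply: NNPP => /eqP x0; apply: nex; by exists x.
have [_ [x xC xC1]] : prime_lt (C (inord 1)) (C ord_max) by apply: chC; rewrite inordK.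
by move: xC xC1; rewrite CP => /PP ->; rewrite rpred0.
Qed.

(** The principal prime (p) has height at most 1. In a chain C_0 < C_1 < (p), p is not in C_1, so an
    x = c p in C_1 but not in C_0 yields such a c of smaller degree: infinite descent. *)
Lemma height_ge2_no_prime_divisor I p :
  height_ge I 2 -> prime_elt p -> (forall x, I x -> divides p x) -> False.
Proof.
move=> htI pp pI.
have [||||P PP] := @prime_idealr_of_predicate S (divides p).
- exact: divides0.
- by apply: prime_elt_not_unit => //; rewrite unitr1.
- by move=> a u v du dv; apply: dividesD => //; apply: divides_mull.
- by case: pp.
have [|C [chC CP]] := htI P; first by move=> x /pI /PP.
have [sub01 [x xC1 xC0]] : prime_lt (C ord0) (C (inord 1)).
  by apply: chC; rewrite inordK.
have [sub12 [y yC2 yC1]] : prime_lt (C (inord 1)) (C ord_max).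
  by apply: chC; rewrite inordK.
have pC1 : p \notin C (inord 1).
  apply: contra yC1; move: yC2; rewrite CP => /PP[c ->] pC1.
  exact: idealMr.
have [p0 pU _] := pp.
have p1 : (1 < msize p)%N.
  rewrite ltnNge; apply: contra pU => p1; have := msize1_polyC p1 => e.
  have c0 : p@_0 != 0 by apply: contraNneq p0 => e0; rewrite e e0.
  by rewrite e; apply: (rmorph_unit (@mpolyC n k)); rewrite unitfE.
have [m] := ubnP (msize x); elim: m x xC1 xC0 => // m IH x xC1 xC0 le_m.
have [c ec] : divides p x by apply/PP; rewrite -CP; apply: sub12.
have x0 : x != 0 by apply: contraNneq xC0 => ->; rewrite rpred0.
have c0 : c != 0 by apply: contraNneq x0 => c0; rewrite ec c0 mul0r.
apply: (IH c).
- by move: xC1; rewrite ec prime_idealrM (negbTE pC1) orbF.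
- by apply: contra xC0; rewrite ec => cC; rewrite mulrC; apply: idealMr.
- by move: le_m p1; rewrite ec msizeM //; move: (msize c) (msize p) => a b; lia.
Qed.

End HeightTwo.

Lemma scalemx_eq0_inj (R : idomainType) m n (d : R) (A : 'M_(m, n)) :
  d != 0 -> d *: A = 0 -> A = 0.
Proof.
move=> d0 /matrixP e; apply/matrixP => i j; apply: (mulfI d0).
by move: (e i j); rewrite !mxE mulr0.
Qed.

(** * Maximal minors of a t x (t+1) matrix and their syzygies *)

Section HilbertBurch.
Variables (S : idomainType) (t : nat) (M : 'M[S]_(t, t.+1)).

Lemma col'_mulmx m (w : 'M_(m, t)) j : w *m col' j M = col' j (w *m M).
Proof. by apply/matrixP => a b; rewrite !mxE; apply: eq_bigr => l _; rewrite mxE. Qed.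

(** The cofactors along a row added on top of [M]; a repeated row then shows that the rows of [M]
    are syzygies. *)
Definition signed_minor (j : 'I_t.+1) : S := (-1) ^+ j * \det (col' j M).

Lemma det_col_mx_minors (v : 'rV_t.+1) :
  \det (col_mx v M : 'M_(1 + t)) = \sum_j v 0 j * signed_minor j.
Proof.
rewrite (expand_det_row _ (lshift t ord0 : 'I_(1 + t))); apply: eq_bigr => j _.
rewrite col_mxEu /cofactor; congr (_ * (_ * \det _)).
apply/matrixP => i l; rewrite !mxE; case: splitP => //= i' /= e; first by move: e; rewrite ord1.
by congr (M _ _); apply: val_inj; move: e => [].
Qed.

Lemma row_signed_minor (i : 'I_t) : \sum_j M i j * signed_minor j = 0.
Proof.
transitivity (\sum_j (row i M) 0 j * signed_minor j).
  by apply: eq_bigr => j _; rewrite mxE.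
rewrite -det_col_mx_minors.
apply: (@determinant_alternate _ _ _ (lshift t ord0 : 'I_(1 + t)) (rshift 1 i)) => //.
by move=> j; rewrite col_mxEu col_mxEd mxE.
Qed.

Lemma mulmx_signed_minor (w : 'rV_t) : \sum_j (w *m M) 0 j * signed_minor j = 0.
Proof.
transitivity (\sum_j \sum_i w 0 i * (M i j * signed_minor j)).
  by apply: eq_bigr => j _; rewrite mxE mulr_suml; apply: eq_bigr => i _; rewrite mulrA.
rewrite exchange_big big1 //= => i _.
by rewrite -mulr_sumr row_signed_minor mulr0.
Qed.

Lemma mulmx_injective_of_minor j (w : 'rV_t) :
  \det (col' j M) != 0 -> w *m M = 0 -> w = 0.
Proof.
move=> d0 e; have e' : w *m col' j M = 0.
  by rewrite col'_mulmx e; apply/matrixP => a b; rewrite !mxE.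
apply: (scalemx_eq0_inj d0).
by rewrite -mul_mx_scalar -mul_mx_adj mulmxA e' mul0mx.
Qed.

(** The adjugate makes all entries except the j-th agree. The difference of both sides is still a
    syzygy, so its remaining entry times a nonzero minor is 0. *)
Lemma mulmx_adj_minor j (v : 'rV_t.+1) :
  \det (col' j M) != 0 -> \sum_l v 0 l * signed_minor l = 0 ->
  (col' j v *m \adj (col' j M)) *m M = \det (col' j M) *: v.
Proof.
move=> d0 ev; set w := _ *m \adj _; pose u := w *m M - \det (col' j M) *: v.
have uj l : l != j -> u 0 l = 0.
  move=> lj; have [l' el] : exists l', l = lift j l'.
    by case: (unliftP j l) lj => [l' -> _|->]; [exists l' | rewrite eqxx].
  have : col' j u = 0.
    rewrite /u linearB /= linearZ /= -col'_mulmx /w -mulmxA mul_adj_mx mul_mx_scalar.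
    by rewrite subrr.
  by move/matrixP => /(_ 0 l'); rewrite !mxE el.
suff uj0 : u 0 j = 0.
  apply/eqP; rewrite -subr_eq0; apply/eqP/rowP => l; rewrite [RHS]mxE.
  by have [->|/uj] := eqVneq l j.
have : \sum_l u 0 l * signed_minor l = 0.
  transitivity (\sum_l (w *m M) 0 l * signed_minor l
      - \det (col' j M) * \sum_l v 0 l * signed_minor l).
    rewrite mulr_sumr -sumrB; apply: eq_bigr => l _.
    by rewrite [u]lock !mxE -lock /u !mxE; ring.
  by rewrite mulmx_signed_minor ev mulr0 subr0.
rewrite (bigD1 j) //= big1 ?addr0 => [|l /uj ->]; last by rewrite mul0r.
by move/eqP; rewrite /signed_minor !mulf_eq0 signr_eq0 (negbTE d0) !orbF => /eqP.
Qed.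

Hypothesis S_fact : factorial_domain S.
Hypothesis minor_neq0 : exists j, \det (col' j M) != 0.
Hypothesis minors_coprime :
  forall p, prime_elt p -> ~ forall j, divides p (\det (col' j M)).

(* Cramer's rule gives s v = u M with s a nonzero minor, and every minor d satisfies
   s | d u; coprimality of the minors yields s | u. *)
Lemma hilbert_burch_exact (v : 'rV_t.+1) :
  \sum_j v 0 j * signed_minor j = 0 -> exists w : 'rV_t, v = w *m M.
Proof.
move=> ev; have [j0 d0] := minor_neq0.
pose d j := \det (col' j M); pose u j := col' j v *m \adj (col' j M).
have eu j : d j != 0 -> u j *m M = d j *: v by move=> dj; apply: mulmx_adj_minor.
(* Both sides become d_j d_j0 v after multiplication by [M], which is injective. If d_j = 0 the left
   side vanishes, and the default 0 keeps the equation true for every [j]. *)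
have cross j : d j *: u j0 = d j0 *: (if d j == 0 then 0 else u j).
  case: ifPn => [/eqP ->|dj]; first by rewrite scale0r scaler0.
  apply/eqP; rewrite -subr_eq0; apply/eqP; apply: (mulmx_injective_of_minor d0).
  by rewrite mulmxBl -!scalemxAl !eu // !scalerA [d j * _]mulrC subrr.
have dvd i : divides (d j0) (u j0 0 i).
  apply: NNPP => nd; have [p pp pd] := prime_of_proper_colon S_fact d0 nd.
  apply: (minors_coprime pp) => j; apply: pd.
  exists ((if d j == 0 then 0 else u j) 0 i).
  by have /matrixP /(_ 0 i) := cross j; rewrite [LHS]mxE [X in _ = X]mxE [RHS]mulrC.
have [w ew] : exists w : 'I_t -> S, forall i, u j0 0 i = w i * d j0.
  by apply: (@fin_all_exists _ _ (fun i c => u j0 0 i = c * d j0)) => i; apply: dvd.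
exists (\row_i w i); apply/eqP; rewrite -subr_eq0; apply/eqP.
apply: (scalemx_eq0_inj d0); rewrite scalerBr -eu // scalemxAl.
apply/eqP; rewrite subr_eq0; apply/eqP; congr (_ *m M).
by apply/rowP => i; rewrite ew !mxE mulrC.
Qed.

End HilbertBurch.

(** * Krull dimension *)

Section KrullDimension.
Variables (k : fieldType) (n : nat).
Local Notation S := {mpoly k[n]}.

Lemma card_bmultinom_le d : (#|{: 'X_{1..n < d.+1}}| <= d.+1 ^ n)%N.
Proof.
rewrite -[X in (_ <= X ^ _)%N]card_ord -[X in (_ <= _ ^ X)%N]card_ord -card_ffun.
pose f (m : 'X_{1..n < d.+1}) : {ffun 'I_n -> 'I_d.+1} := [ffun i => inord (m i)].
apply: (@leq_card _ _ f) => m1 m2 /ffunP e; apply/val_inj/mnmP => i.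
have lt (m : 'X_{1..n < d.+1}) : (m i < d.+1)%N.
  by apply: leq_ltn_trans (bmdeg m); rewrite mdegE (bigD1 i) //= leq_addr.
by move: (e i); rewrite !ffunE => /(congr1 (@nat_of_ord _)); rewrite !inordK.
Qed.

Lemma card_independent_le (T : finType) (b : T -> S) d :
  (forall t, (msize (b t) <= d)%N) ->
  (forall c : T -> k, \sum_t c t *: b t = 0 -> forall t, c t = 0) ->
  (#|T| <= #|{: 'X_{1..n < d}}|)%N.
Proof.
move=> le_d ind.
pose A := \matrix_(i < #|T|, j < #|{: 'X_{1..n < d}}|)
  (b (enum_val i))@_(enum_val j : 'X_{1..n < d}).
suff /eqP <- : row_free A by apply: rank_leq_col.
apply: inj_row_free => v e; apply/rowP => i; rewrite mxE.
rewrite -[i]enum_valK; move: (enum_val i) => t.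
apply: (ind (fun t => v 0 (enum_rank t))) => {t i}.
apply/mpolyP => m; rewrite mcoeff0 raddf_sum /=.
have [lt_m|le_m] := ltnP (mdeg m) d; last first.
  rewrite big1 // => t _; rewrite mcoeffZ memN_msupp_eq0 ?mulr0 //.
  apply: contraL le_m => /msize_mdeg_lt; rewrite -ltnNge => lt.
  exact: leq_trans lt (le_d t).
move/rowP: e => /(_ (enum_rank (BMultinom lt_m))); rewrite !mxE; apply: etrans.
rewrite (reindex _ (onW_bij _ (@enum_val_bij T))); apply: eq_bigr => i _ /=.
by rewrite mxE enum_rankK mcoeffZ enum_valK.
Qed.

Lemma msizeM_leq (p q : S) : (msize (p * q) <= (msize p + msize q).-1)%N.
Proof.
have [->|p0] := eqVneq p 0; first by rewrite mul0r msize0.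
have [->|q0] := eqVneq q 0; first by rewrite mulr0 msize0.
by rewrite msizeM.
Qed.

(* The products g_1^a_1 ... g_m^a_m, with g_i in C_i but not in C_(i-1) and all
   a_i < q, are linearly independent modulo C_0. *)
Lemma independent_of_prime_chain m (C : nat -> prime_idealr S) :
  (forall i, (i < m)%N -> prime_lt (C i) (C i.+1)) ->
  exists E, forall q, exists (T : finType) (b : T -> S),
    [/\ #|T| = (q ^ m)%N, forall t, (msize (b t) <= (E * q).+1)%N
      & forall c : T -> k, \sum_t c t *: b t \in C 0%N -> forall t, c t = 0].
Proof.
elim: m C => [|m IH] C chC.
  exists 0%N => q; exists unit, (fun _ => 1); split; first by rewrite card_unit.
    by move=> _; rewrite msize1.
  move=> c; rewrite (big_pred1 tt) => [|[]//] cC [].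
  apply: contraTeq cC => c0; apply/negP => cC.
  have : 1 \in C 0%N.
    have -> : 1 = (c tt)^-1%:MP * (c tt *: 1 : S).
      by rewrite mul_mpolyC scalerA mulVf // scale1r.
    exact: idealMr.
  by rewrite idealr1.
have [E HE] := IH (fun i => C i.+1) (fun i lt => chC i.+1 lt).
have [sub01 [g gC1 gC0]] := chC 0%N isT.
exists (msize g + E)%N => q; have [T [b [cT le_b ind]]] := HE q.
exists ('I_q * T)%type, (fun x : 'I_q * T => g ^+ x.1 * b x.2); split.
- by rewrite card_prod card_ord cT expnS.
- case=> a t /=; apply: leq_trans (msizeM_leq _ _) _.
  have le_g : (msize (g ^+ a) <= (msize g * q).+1)%N.
    apply: (@leq_trans (msize g * a).+1); last by rewrite ltnS leq_mul2l ltnW ?orbT.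
    elim: {a}(a : nat) => [|a IHa]; first by rewrite expr0 msize1.
    rewrite exprS; apply: leq_trans (msizeM_leq _ _) _.
    by move: IHa; rewrite mulnS; move: (msize _) (msize g * a)%N (msize g) => x y z; lia.
  move: (le_b t) le_g; rewrite mulnDl.
  by move: (msize _) (msize (g ^+ a)) (msize g * q)%N (E * q)%N => x y z w; lia.
move=> c cC; suff H a t : (a < q)%N -> forall lt : (a < q)%N, c (Ordinal lt, t) = 0.
  by case=> -[a lt] t; apply: H.
(* Strong induction on the exponent of [g]: lower terms vanish, so g^a (y_a + g z) lies in C_0. As
   C_0 is prime and omits [g], it contains y_a + g z; hence y_a is in C_1, where independence is
   already known. *)
elim/ltn_ind: a t => a IHa t _ lt.
pose y (a : 'I_q) := \sum_t c (a, t) *: b t.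
have ey : \sum_x c x *: (g ^+ x.1 * b x.2) = \sum_(a < q) g ^+ a * y a.
  transitivity (\sum_(a < q) \sum_t c (a, t) *: (g ^+ a * b t)).
    by rewrite pair_bigA; apply: eq_bigr => -[].
  by apply: eq_bigr => i _; rewrite mulr_sumr; apply: eq_bigr => s _; rewrite scalerAr.
have y0 (i : 'I_q) : (i < a)%N -> y i = 0.
  move=> ia; rewrite /y big1 // => s _.
  by case: i ia => i lti /= ia; rewrite IHa ?scale0r.
move: cC; rewrite ey (bigD1 (Ordinal lt)) //= => cC.
have [z ez] : exists z, \sum_(i < q | i != Ordinal lt) g ^+ i * y i = g ^+ a * (g * z).
  exists (\sum_(i < q | i != Ordinal lt) if (a < i)%N then g ^+ (i - a.+1) * y i else 0).
  rewrite !mulr_sumr; apply: eq_bigr => i ni; case: ltnP => [ai|].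
    by rewrite !mulrA -exprSr -exprD subnKC.
  rewrite leq_eqVlt => /orP[/eqP e|/y0 ->]; last by rewrite !mulr0.
  by case/eqP: ni; apply: val_inj.
move: cC; rewrite ez -mulrDr prime_idealrM => /orP[ga|yz].
  case/negP: gC0; elim: {lt IHa y0 ez}a ga => [|a IHa].
    by rewrite expr0 idealr1.
  by rewrite exprS prime_idealrM => /orP[].
apply: (ind (fun t => c (Ordinal lt, t))).
rewrite -[X in X \in _](addrK (g * z)); apply: rpredB; first exact: sub01.
by rewrite mulrC; apply: idealMr.
Qed.

(** Growth comparison: a chain of length m gives q^m independent polynomials of degree at most E q,
    inside a space of dimension at most ((E+1) q)^n. For m > n this bounds every positive q by
    (E+1)^n. *)
Lemma prime_chain_length_le m (C : nat -> prime_idealr S) :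
  (forall i, (i < m)%N -> prime_lt (C i) (C i.+1)) -> (m <= n)%N.
Proof.
move=> /independent_of_prime_chain [E HE]; rewrite leqNgt; apply/negP => lt_nm.
have bound q : (0 < q)%N -> (q <= E.+1 ^ n)%N.
  move=> q0; have [T [b [cT le_b ind]]] := HE q.
  have : (q ^ m <= (E.+1 * q) ^ n)%N.
    rewrite -cT; apply: leq_trans (card_independent_le le_b _) _.
      by move=> c e; apply: ind; rewrite e rpred0.
    apply: leq_trans (card_bmultinom_le _) _.
    case: n => // n'; rewrite leq_exp2r //.
    by rewrite mulSn addnC -addn1 leq_add2l.
  have le_q : (q ^ n.+1 <= q ^ m)%N by rewrite leq_pexp2l.
  by move/(leq_trans le_q); rewrite expnMn expnS leq_pmul2r // expn_gt0 q0.
by have := bound (E.+1 ^ n).+1 isT; rewrite ltnn.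
Qed.

Lemma quotient_dim_of_height_ge2 (I : S -> Prop) d :
  height_ge I 2 -> quotient_dim_ge I d -> (d.+2 <= n)%N.
Proof.
move=> htI [C [chC CI]]; have [C' [chC' e]] := htI (C ord0) (CI ord0).
(* The last prime of [C'] has the same elements as [C ord0], so only its first two primes are put in
   front of [C]. *)
pose D i : prime_idealr S := if (i < 2)%N then C' (inord i) else C (inord (i - 2)).
apply: (@prime_chain_length_le _ D) => -[|[|i]] lti; rewrite /D /=.
- by apply: chC'; rewrite !inordK.
- have [sub lt] : prime_lt (C' (inord 1)) (C' ord_max) by apply: chC'; rewrite inordK.
  have -> : inord (2 - 2) = ord0 :> 'I_d.+1 by apply: val_inj; rewrite /= inordK.
  split; first by move=> x /sub; rewrite e.
  by case: lt => x; rewrite e => xC nx; exists x.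
- by apply: chC; rewrite !inordK ?subn2 //= ltnW.
Qed.

End KrullDimension.

(** * Hilbert functions *)

(** Dimension count for an exact sequence 0 -> k^A -> k^B -> k^C -> 0. With bases as finite types
    and [f], [g] as matrices, dimensions are cardinalities. *)
Lemma card_exact_sequence (k : fieldType) (A B C : finType)
    (f : A -> B -> k) (g : B -> C -> k) :
  (forall x : A -> k, (forall b, \sum_a x a * f a b = 0) -> forall a, x a = 0) ->
  (forall a c, \sum_b f a b * g b c = 0) ->
  (forall y : B -> k, (forall c, \sum_b y b * g b c = 0) ->
     exists x : A -> k, forall b, y b = \sum_a x a * f a b) ->
  (forall z : C -> k, exists y : B -> k, forall c, z c = \sum_b y b * g b c) ->
  #|B| = (#|A| + #|C|)%N.
Proof.
move=> f_inj gf0 ker_g g_surj.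
pose mat (X Y : finType) (h : X -> Y -> k) :=
  \matrix_(i < #|X|, j < #|Y|) h (enum_val i) (enum_val j).
have mulE (X Y : finType) (h : X -> Y -> k) m (u : 'M_(m, _)) i y :
    (u *m mat X Y h) i (enum_rank y) = \sum_x u i (enum_rank x) * h x y.
  rewrite mxE (reindex _ (onW_bij _ (@enum_val_bij X))); apply: eq_bigr => j _.
  by rewrite mxE enum_rankK enum_valK.
have free_f : row_free (mat A B f).
  apply: inj_row_free => v /rowP v0; apply/rowP => i; rewrite mxE -[i]enum_valK.
  apply: (f_inj (fun a => v 0 (enum_rank a))) => b.
  by rewrite -mulE v0 mxE.
have full_g : row_full (mat B C g).
  rewrite -sub1mx; apply/row_subP => i.
  have [y ey] := g_surj (fun c => (c == enum_val i)%:R).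
  apply/submxP; exists (\row_b y (enum_val b)); apply/rowP => j.
  rewrite -[j]enum_valK mulE !mxE -(inj_eq enum_val_inj) enum_rankK eq_sym ey.
  by apply: eq_bigr => b _; rewrite mxE enum_rankK.
have ker : (kermx (mat B C g) :=: mat A B f)%MS.
  apply/eqmxP/andP; split; last first.
    apply/sub_kermxP/matrixP => i c; rewrite -[c]enum_valK mulE mxE.
    rewrite -[RHS](gf0 (enum_val i) (enum_val c)).
    by apply: eq_bigr => b _; rewrite mxE enum_rankK.
  apply/row_subP => i; have [|x ex] := ker_g (fun b => kermx (mat B C g) i (enum_rank b)).
    by move=> c; rewrite -mulE mulmx_ker mxE.
  apply/submxP; exists (\row_a x (enum_val a)); apply/rowP => j.
  rewrite -[j]enum_valK mulE mxE ex.
  by apply: eq_bigr => a _; rewrite mxE enum_rankK.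
have := mxrank_ker (mat B C g); have := rank_leq_row (mat B C g).
by rewrite ker (eqP free_f) (eqP full_g) => le ->; rewrite subnK.
Qed.

Section Twist.
Variables (k : fieldType) (n : nat).
Local Notation S := {mpoly k[n]}.
Implicit Types (p q : S) (e i d : nat).

(* p belongs to the degree i component of the twist S(-e), which is 0 for i < e. *)
Definition twist_homog e i p := forall m, m \in msupp p -> (mdeg m + e)%N = i.

(** The test is essential: for i < e the truncated difference i - e is 0 and would select
    constants. *)
Definition twist_proj e i p : S :=
  if (e <= i)%N then pihomog mdeg (i - e) p else 0.

Lemma twist_proj0 e i : twist_proj e i 0 = 0.
Proof. by rewrite /twist_proj linear0 if_same. Qed.

Lemma twist_projD e i : {morph twist_proj e i : p q / p + q}.
Proof. by move=> p q; rewrite /twist_proj linearD; case: ifP; rewrite ?addr0. Qed.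

Lemma twist_proj_sum e i (T : finType) (F : T -> S) :
  twist_proj e i (\sum_x F x) = \sum_x twist_proj e i (F x).
Proof. exact: (big_morph _ (twist_projD e i) (twist_proj0 e i)). Qed.

Lemma twist_projP e i p : twist_homog e i (twist_proj e i p).
Proof.
rewrite /twist_proj; case: leqP => [le_ei|_] m; last by rewrite msupp0.
by move/(dhomogP _ _ _ (pihomogP _ _ _)) => ->; rewrite subnK.
Qed.

Lemma twist_homog_dhomog e i p : (e <= i)%N -> twist_homog e i p <-> p \is (i - e).-homog.
Proof.
move=> le_ei; split=> [H|/dhomogP H m /H ->]; last by rewrite subnK.
by apply/dhomogP => m /H <-; rewrite addnK.
Qed.

Lemma twist_homog0 i p : twist_homog 0 i p <-> p \is i.-homog.
Proof. by have := twist_homog_dhomog p (leq0n i); rewrite subn0. Qed.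

Lemma twist_homog_big e i p : (i < e)%N -> twist_homog e i p -> p = 0.
Proof.
move=> lt_ie H; apply/eqP; rewrite -msupp_eq0; case E: (msupp p) => [//|m s].
have /H : m \in msupp p by rewrite E mem_head.
by move: lt_ie => /[swap] <-; rewrite ltnNge leq_addl.
Qed.

Lemma twist_proj_id e i p : twist_homog e i p -> twist_proj e i p = p.
Proof.
rewrite /twist_proj; case: leqP => [le_ei|lt_ie].
  by move/(twist_homog_dhomog _ le_ei)/pihomog_dE.
by move/(twist_homog_big lt_ie).
Qed.

(** Multiplication by a form of degree d is a graded map S(-(e+d)) -> S(-e), so it commutes with
    taking degree i components. *)
Lemma twist_projM e i d p q : q \is d.-homog ->
  twist_proj e i (p * q) = twist_proj (e + d) i p * q.
Proof.
move=> hq; elim/mpolyind: p => [|c m p _ _ IH]; first by rewrite mul0r !twist_proj0 mul0r.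
rewrite mulrDl !twist_projD mulrDl IH; congr (_ + _).
have hm : (c *: 'X_[m]) * q \is (mdeg m + d).-homog.
  by apply: dhomogM => //; apply: dhomogZ; rewrite dhomogX.
rewrite /twist_proj [in RHS]linearZ /=.
have [em|nem] := eqVneq (mdeg m + d + e)%N i.
  have le1 : (e <= i)%N by lia.
  have le2 : (e + d <= i)%N by lia.
  have e1 : mdeg m = (i - (e + d))%N by lia.
  have e2 : (mdeg m + d)%N = (i - e)%N by lia.
  rewrite le1 le2 (_ : pihomog _ (i - (e + d)) _ = 'X_[m]).
    by apply: pihomog_dE; rewrite -e2.
  by apply: pihomog_dE; rewrite dhomogX; apply/eqP.
rewrite (_ : (if (e + d <= i)%N then _ else _) = 0); last first.
  case: leqP => // le2; rewrite (@pihomog_ne0 _ _ _ (mdeg m)) ?scaler0 ?dhomogX //.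
  by apply: contra nem => /eqP e1; apply/eqP; lia.
rewrite mul0r; case: leqP => // le1; apply: (pihomog_ne0 _ hm).
by apply: contra nem => /eqP em; apply/eqP; lia.
Qed.

Lemma twist_homogM e i d p q : q \is d.-homog ->
  twist_homog (e + d) i p -> twist_homog e i (p * q).
Proof.
move=> hq /twist_proj_id <-; rewrite -twist_projM //; exact: twist_projP.
Qed.

Lemma twist_homogD e i p q :
  twist_homog e i p -> twist_homog e i q -> twist_homog e i (p + q).
Proof.
move=> /twist_proj_id <- /twist_proj_id <-; rewrite -twist_projD; exact: twist_projP.
Qed.

Lemma twist_homogZ e i c p : twist_homog e i p -> twist_homog e i (c *: p).
Proof. by move=> H m /msuppZ_le /H. Qed.

Lemma twist_homog_sum e i (T : finType) (P : pred T) (F : T -> S) :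
  (forall x, P x -> twist_homog e i (F x)) -> twist_homog e i (\sum_(x | P x) F x).
Proof.
move=> H; elim/big_ind: _ => //; last by move=> *; apply: twist_homogD.
by move=> m; rewrite msupp0.
Qed.

Lemma twist_homog_eq0 e i p : twist_homog e i p ->
  (forall m, (mdeg m + e)%N = i -> p@_m = 0) -> p = 0.
Proof.
move=> H H0; apply/mpolyP => m; rewrite mcoeff0.
have [/H /H0 //|] := boolP (m \in msupp p).
exact: memN_msupp_eq0.
Qed.

Variables (N : nat) (e : 'I_N -> nat) (i : nat).

(* The monomial basis of the degree i component of \bigoplus_j S(-e j). *)
Definition twist_index :=
  {u : 'I_N * 'X_{1..n < i.+1} | (mdeg u.2 + e u.1 == i)%N}.

Definition twist_poly (y : twist_index -> k) (j : 'I_N) : S :=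
  \sum_(u | (val u).1 == j) y u *: 'X_[(val u).2].

Lemma twist_poly_homog y j : twist_homog (e j) i (twist_poly y j).
Proof.
apply: twist_homog_sum => u /eqP <-; apply: twist_homogZ => m.
by rewrite msuppX inE => /eqP ->; apply/eqP; apply: (valP u).
Qed.

Lemma mcoeff_twist_poly y (u : twist_index) : (twist_poly y (val u).1)@_((val u).2) = y u.
Proof.
rewrite /twist_poly raddf_sum (bigD1 u) //= big1 => [|w /andP[/eqP e1 nw]].
  by rewrite addr0 mcoeffZ mcoeffX eqxx mulr1.
rewrite mcoeffZ mcoeffX; case: eqP => [e2|]; rewrite ?mulr0 //.
case/eqP: nw; apply: val_inj; apply/eqP/andP; split; first exact/eqP.
exact/eqP/val_inj.
Qed.

Lemma twist_index_of j (m : 'X_{1..n}) : (mdeg m + e j)%N = i ->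
  exists u : twist_index, (val u).1 = j /\ ((val u).2 : 'X_{1..n}) = m.
Proof.
move=> em; have lt : (mdeg m < i.+1)%N by rewrite ltnS -em leq_addr.
have P : (mdeg (BMultinom lt) + e j == i)%N by apply/eqP.
by exists (exist _ (j, BMultinom lt) P).
Qed.

Lemma twist_polyK (v : 'I_N -> S) j : twist_homog (e j) i (v j) ->
  twist_poly (fun u : twist_index => (v (val u).1)@_((val u).2)) j = v j.
Proof.
move=> H; apply/eqP; rewrite -subr_eq0; apply/eqP.
apply: (@twist_homog_eq0 (e j) i).
  apply: twist_homogD; first exact: twist_poly_homog.
  by rewrite -scaleN1r; apply: twist_homogZ.
move=> m /twist_index_of [u [<- <-]].
by rewrite mcoeffB mcoeff_twist_poly subrr.
Qed.

Lemma twist_poly_sum (y : twist_index -> k) (D : 'I_N -> S) :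
  \sum_(u : twist_index) y u *: ('X_[(val u).2] * D (val u).1) = \sum_j twist_poly y j * D j.
Proof.
rewrite (partition_big (fun u : twist_index => (val u).1) xpredT) //=.
apply: eq_bigr => j _; rewrite /twist_poly mulr_suml.
by apply: eq_bigr => u /eqP <-; rewrite scalerAl.
Qed.

Lemma card_twist_index :
  #|{: twist_index}| = (\sum_j #|[pred m : 'X_{1..n < i.+1} | mdeg m + e j == i]|)%N.
Proof.
rewrite card_sig -sum1_card.
transitivity (\sum_j \sum_(m : 'X_{1..n < i.+1} | mdeg m + e j == i) 1)%N.
  by rewrite pair_big_dep.
by apply: eq_bigr => j _; rewrite sum1_card.
Qed.

End Twist.

(** * The Hilbert function from the Hilbert-Burch resolution *)

Section HilbertFunction.
Variables (k : fieldType) (n t : nat).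
Local Notation S := {mpoly k[n]}.
Variables (M : 'M[S]_(t, t.+1)) (I : S -> Prop).
Variables (E : 'I_t.+1 -> nat) (C : 'I_t -> nat).
Local Notation D := (signed_minor M).

Hypothesis M_homog : forall l j,
  M l j = 0 \/ exists2 d, (E j + d = C l)%N & M l j \is d.-homog.
Hypothesis D_homog : forall j, D j \is (E j).-homog.
Hypothesis M_inj : forall w : 'rV_t, w *m M = 0 -> w = 0.
Hypothesis M_exact : forall v : 'rV_t.+1, \sum_j v 0 j * D j = 0 ->
  exists w : 'rV_t, v = w *m M.
Hypothesis I_gen : forall p, I p <-> exists c : 'I_t.+1 -> S, p = \sum_j c j * D j.

Lemma twist_homog_mulM i l j w :
  twist_homog (C l) i w -> twist_homog (E j) i (w * M l j).
Proof.
case: (M_homog l j) => [->|[d <- hd] hw]; last exact: twist_homogM hd hw.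
by rewrite mulr0 => _ m; rewrite msupp0.
Qed.

Lemma twist_proj_mulM i l j w :
  twist_proj (E j) i (w * M l j) = twist_proj (C l) i w * M l j.
Proof.
by case: (M_homog l j) => [->|[d <- hd]]; rewrite ?mulr0 ?twist_proj0 // -twist_projM.
Qed.

Lemma homog_sum_minors i (v : 'I_t.+1 -> S) :
  (forall j, twist_homog (E j) i (v j)) -> \sum_j v j * D j \is i.-homog.
Proof.
move=> hv; apply/twist_homog0; apply: twist_homog_sum => j _.
by apply: (twist_homogM (D_homog j)); apply: hv.
Qed.

(** The degree i part of the resolution, with S/I replaced by lifts [e] of a basis: 0 -> (sum of the
    S(-C_l))_i -> k^r + (sum of the S(-E_j))_i -> S_i -> 0. Every space in it has an explicit basis
    and no quotient is formed. *)
Lemma card_hilbert_value i r : has_hilbert_value I i r ->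
  (r + #|{: twist_index n E i}|
   = #|{: twist_index n C i}| + #|[pred m : 'X_{1..n < i.+1} | mdeg m == i]|)%N.
Proof.
move=> [e [e_homog e_basis]].
pose T0 := {m : 'X_{1..n < i.+1} | mdeg m == i}.
pose TE := twist_index n E i; pose TC := twist_index n C i.
pose f (a : TC) (b : 'I_r + TE) : k := match b with
  | inl _ => 0
  | inr u => ('X_[(val a).2] * M (val a).1 (val u).1)@_((val u).2)
  end.
pose gp (b : 'I_r + TE) : S := match b with
  | inl q => e q
  | inr u => 'X_[(val u).2] * D (val u).1
  end.
pose g b (c : T0) : k := (gp b)@_(val c).
have sum_gp (y : 'I_r + TE -> k) : \sum_b y b *: gp b
    = \sum_q y (inl q) *: e q + \sum_j twist_poly (fun u => y (inr u)) j * D j.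
  by rewrite big_sumType /= twist_poly_sum.
have sum_g (y : 'I_r + TE -> k) c : \sum_b y b * g b c = (\sum_b y b *: gp b)@_(val c).
  by rewrite raddf_sum; apply: eq_bigr => b _; rewrite /= mcoeffZ.
have homog_gp (y : 'I_r + TE -> k) : \sum_b y b *: gp b \is i.-homog.
  rewrite sum_gp rpredD //; first by apply: rpred_sum => q _; apply: rpredZ.
  by apply: homog_sum_minors => j; apply: twist_poly_homog.
have homog0 (p : S) : p \is i.-homog -> (forall c : T0, p@_(val c) = 0) -> p = 0.
  move=> /twist_homog0 hp p0; apply: (twist_homog_eq0 hp) => m; rewrite addn0 => em.
  have lt : (mdeg m < i.+1)%N by rewrite em.
  have P : mdeg (BMultinom lt) == i by apply/eqP.
  exact: (p0 (exist _ (BMultinom lt) P)).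
have sum_f (x : TC -> k) u : \sum_a x a * f a (inr u)
    = (\sum_l twist_poly x l * M l (val u).1)@_((val u).2).
  rewrite -(twist_poly_sum x (fun l => M l (val u).1)) raddf_sum.
  by apply: eq_bigr => a _; rewrite /= mcoeffZ.
have homog_f (x : TC -> k) j : twist_homog (E j) i (\sum_l twist_poly x l * M l j).
  by apply: twist_homog_sum => l _; apply/twist_homog_mulM/twist_poly_homog.
have -> : #|[pred m : 'X_{1..n < i.+1} | mdeg m == i]| = #|{: T0}| by rewrite card_sig.
rewrite -[X in (X + _)%N]card_ord -card_sum.
apply: (card_exact_sequence (f := f) (g := g)).
- move=> x x0.
  have w0 : \row_l twist_poly x l *m M = 0.
    apply/rowP => j; rewrite !mxE; apply: (twist_homog_eq0 (e := E j) (i := i)).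
      by under eq_bigr do rewrite mxE; apply: homog_f.
    move=> m /twist_index_of [u [<- <-]]; rewrite -[RHS](x0 (inr u)) sum_f.
    by congr (_@_ _); apply: eq_bigr => l _; rewrite mxE.
  move=> a; rewrite -mcoeff_twist_poly.
  by have /rowP /(_ (val a).1) := M_inj w0; rewrite !mxE => ->; rewrite mcoeff0.
- move=> a c; rewrite sum_g sum_gp big1 ?add0r => [|q _]; last by rewrite scale0r.
  have -> : \sum_j twist_poly (fun u => f a (inr u)) j * D j
      = \sum_j ('X_[(val a).2] * M (val a).1 j) * D j.
    apply: eq_bigr => j _; congr (_ * _).
    apply: (twist_polyK (v := fun j => 'X_[(val a).2] * M (val a).1 j)).
    apply: twist_homog_mulM => m; rewrite msuppX inE => /eqP ->.
    exact/eqP/(valP a).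
  under eq_bigr do rewrite -mulrA.
  by rewrite -mulr_sumr row_signed_minor mulr0 mcoeff0.
- move=> y y0; have := homog0 _ (homog_gp y).
  rewrite sum_gp; set v := twist_poly _ => sum0.
  have {}sum0 : \sum_q y (inl q) *: e q + \sum_j v j * D j = 0.
    by apply: sum0 => c; rewrite -sum_gp -sum_g.
  (* Both 0 and the coefficients of the [e q] represent the zero class of S/I; uniqueness identifies
     them. *)
  have yl q : y (inl q) = 0.
    have [c [_ c_uniq]] := e_basis 0 (rpred0 _).
    have -> : y (inl q) = (\row_q y (inl q)) 0 q by rewrite mxE.
    rewrite -(c_uniq (\row_q y (inl q))).
      rewrite (c_uniq 0) ?mxE //; apply/I_gen; exists (fun=> 0).
      by rewrite !big1 ?subr0 // => j _; rewrite ?mxE ?scale0r ?mul0r.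
    apply/I_gen; exists v; under eq_bigr do rewrite mxE.
    by apply/eqP; rewrite sub0r eq_sym -subr_eq0 opprK addrC sum0.
  have [|w ew] := @M_exact (\row_j v j).
    rewrite -[RHS]sum0 [X in _ = X + _]big1 ?add0r => [|q _]; last by rewrite yl scale0r.
    by apply: eq_bigr => j _; rewrite mxE.
  (* The coefficients supplied by exactness need not be homogeneous; their components of the right
     degree already express [v], which is homogeneous. *)
  pose w' l := twist_proj (C l) i (w 0 l).
  have ev j : v j = \sum_l w' l * M l j.
    rewrite -[LHS](@twist_proj_id _ _ (E j) i); last exact: twist_poly_homog.
    have -> : v j = \sum_l w 0 l * M l j by have /rowP /(_ j) := ew; rewrite !mxE.
    by rewrite twist_proj_sum; apply: eq_bigr => l _; rewrite twist_proj_mulM.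
  exists (fun a : TC => (w' (val a).1)@_((val a).2)) => -[q|u].
    by rewrite yl big1 // => a _; rewrite mulr0.
  rewrite sum_f -(mcoeff_twist_poly (fun u => y (inr u))) -/v ev.
  congr (_@_ _); apply: eq_bigr => l _; rewrite (twist_polyK (v := w')) //.
  exact: twist_projP.
- move=> z; pose p : S := \sum_c z c *: 'X_[val c].
  have hp : p \is i.-homog.
    apply: rpred_sum => c _; apply: rpredZ; rewrite dhomogX; exact: (valP c).
  have zE c : z c = p@_(val c).
    rewrite /p raddf_sum (bigD1 c) //= big1 => [|c' nc].
      by rewrite addr0 /= mcoeffZ mcoeffX eqxx mulr1.
    rewrite /= mcoeffZ mcoeffX; case: eqP => [ec|]; rewrite ?mulr0 //.
    by case/eqP: nc; apply/val_inj/val_inj.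
  have [c [/I_gen [v ev] _]] := e_basis p hp.
  pose v' j := twist_proj (E j) i (v j).
  exists (fun b => match b with
    | inl q => c 0 q
    | inr u => (v' (val (u : TE)).1)@_((val (u : TE)).2)
    end).
  move=> c'; rewrite sum_g sum_gp zE; congr (_@_ _).
  have -> : \sum_j twist_poly (fun u : TE => (v' (val u).1)@_((val u).2)) j * D j
      = \sum_j v' j * D j.
    by apply: eq_bigr => j _; rewrite (twist_polyK (v := v')) //; apply: twist_projP.
  apply/eqP; rewrite addrC -subr_eq; apply/eqP.
  rewrite -[LHS](@twist_proj_id _ _ 0 i); last first.
    apply/twist_homog0; apply: rpredB => //.
    by apply: rpred_sum => q _; apply: rpredZ; apply: e_homog.
  rewrite ev twist_proj_sum; apply: eq_bigr => j _.
  by rewrite (twist_projM _ _ _ (D_homog j)).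
Qed.

End HilbertFunction.

Lemma card_pred_inj_le (T1 T2 : finType) (A : pred T1) (B : pred T2) (f : T1 -> T2) :
  {in A &, injective f} -> (forall x, A x -> B (f x)) -> (#|A| <= #|B|)%N.
Proof.
move=> f_inj AB; rewrite -(card_in_image f_inj); apply: subset_leq_card.
by apply/subsetP => _ /imageP[x Ax ->]; apply: AB.
Qed.

(** * From Hilbert functions to the numerator of the Hilbert series *)

Section HilbertSeries.
Variable n : nat.

(* For d <= N, the number of monomials of degree d in n variables. *)
Definition bounded_monomials N d :=
  #|[pred f : {ffun 'I_n -> 'I_N.+1} | (\sum_i f i)%N == d]|.

Lemma card_mdeg_eq b d N : (d < b)%N -> (d <= N)%N ->
  #|[pred m : 'X_{1..n < b} | mdeg m == d]| = bounded_monomials N d.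
Proof.
case: b => // b lt_db le_dN.
have le_mdeg (m : 'X_{1..n}) i : (m i <= mdeg m)%N.
  by rewrite mdegE (bigD1 i) //= leq_addr.
apply/eqP; rewrite eqn_leq; apply/andP; split.
  pose f (m : 'X_{1..n < b.+1}) := [ffun i => inord (m i) : 'I_N.+1].
  have fE m i : mdeg (bmnm m) == d -> f m i = m i :> nat.
    by move=> /eqP em; rewrite ffunE inordK // ltnS (leq_trans _ le_dN) // -em.
  apply: (@card_pred_inj_le _ _ _ _ f) => [m1 m2 h1 h2 e|m hm /=].
    by apply/val_inj/mnmP => i; rewrite -!fE // e.
  move: (hm) => /= /eqP <-; rewrite mdegE; apply/eqP; apply: eq_bigr => i _.
  exact: fE.
have lt (f : {ffun 'I_n -> 'I_N.+1}) : (\sum_i f i)%N == d ->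
    (mdeg [multinom (f i : nat) | i < n] < b.+1)%N.
  move=> /eqP ef; rewrite mdegE (eq_bigr (fun i => f i : nat)) ?ef // => i _.
  by rewrite mnmE.
pose g (f : {ffun 'I_n -> 'I_N.+1}) : 'X_{1..n < b.+1} :=
  insubd (@bm0 n b) [multinom (f i : nat) | i < n].
have gE (f : {ffun 'I_n -> 'I_N.+1}) : (\sum_i f i)%N == d ->
    g f = [multinom (f i : nat) | i < n] :> 'X_{1..n}.
  by move=> /lt hf; rewrite /g [LHS]insubdK.
apply: (@card_pred_inj_le _ _ _ _ g) => [f1 f2 h1 h2 e|f hf /=].
  apply/ffunP => i; apply: val_inj.
  have /mnmP /(_ i) : (g f1 : 'X_{1..n}) = g f2 by rewrite e.
  by rewrite !gE // !mnmE.
rewrite gE // mdegE; move: (hf) => /= /eqP <-; apply/eqP.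
by apply: eq_bigr => i _; rewrite mnmE.
Qed.

Lemma card_twist_mdeg e i N : (i <= N)%N ->
  #|[pred m : 'X_{1..n < i.+1} | mdeg m + e == i]%N|
  = (if (i < e)%N then 0 else bounded_monomials N (i - e))%N.
Proof.
move=> le_iN; case: ltnP => [lt_ie|le_ei].
  apply: eq_card0 => m; rewrite !inE; apply/negbTE.
  by apply: contraL lt_ie => /eqP <-; rewrite -leqNgt leq_addl.
rewrite -(@card_mdeg_eq i.+1) ?ltnS ?leq_subr ?(leq_trans (leq_subr _ _)) //.
by apply: eq_card => m; rewrite !inE -(eqn_add2r e (mdeg m)) subnK.
Qed.

(** Agrees with the power series (1 - z)^(-n) through degree [N], so polynomials suffice for
    comparing coefficients. *)
Definition truncated_series N : {poly int} := (\sum_(a < N.+1) 'X^a) ^+ n.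

Lemma coef_truncated_series N d :
  (truncated_series N)`_d = (bounded_monomials N d)%:Z.
Proof.
rewrite /truncated_series -[X in _ ^+ X]card_ord -prodr_const bigA_distr_bigA /=.
rewrite coef_sum /bounded_monomials -sum1_card [in RHS]big_mkcond /= -natz natr_sum.
apply: eq_bigr => f _; rewrite prodrXr coefXn eq_sym inE.
by case: eqP.
Qed.

Lemma geometric_sum (R : pzRingType) (x : R) p :
  (1 - x) * \sum_(i < p) x ^+ i = 1 - x ^+ p.
Proof. by rewrite -[LHS]opprK -mulNr opprB -subrX1 opprB. Qed.

Lemma coef_truncated_inverse N i : (i <= N)%N ->
  ((1 - 'X) ^+ n * truncated_series N)`_i = (i == 0)%:R.
Proof.
move=> le_iN; rewrite -exprMn geometric_sum.
have [q ->] : exists q : {poly int}, (1 - 'X^(N.+1)) ^+ n = 1 + 'X^(N.+1) * q.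
  elim: (n) => [|m [q IH]]; first by exists 0; rewrite mulr0 addr0.
  by exists (q - 1 - 'X^(N.+1) * q); rewrite exprS IH; ring.
by rewrite coefD coefXnM ltnS le_iN addr0 coef1.
Qed.

Lemma coef_mull_congr (N : nat) (r p q : {poly int}) :
  (forall i, (i <= N)%N -> p`_i = q`_i) ->
  forall i, (i <= N)%N -> (r * p)`_i = (r * q)`_i.
Proof.
move=> pq i le_iN; rewrite !coefM; apply: eq_bigr => j _.
by rewrite pq // (leq_trans (leq_subr _ _)).
Qed.

Definition resolution_numerator t (E : 'I_t.+1 -> nat) (C : 'I_t -> nat) : {poly int} :=
  1 - \sum_j 'X^(E j) + \sum_l 'X^(C l).

(** Coefficients are compared one at a time: for the coefficient [N], all series are truncated after
    degree [N], where the Hilbert series equals the numerator times (1 - z)^(-n). *)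
Lemma hilbert_numerator t (E : 'I_t.+1 -> nat) (C : 'I_t -> nat) (H : nat -> nat)
    (hp : {poly int}) d :
  (forall i, H i + #|{: twist_index n E i}|
     = #|{: twist_index n C i}| + #|[pred m : 'X_{1..n < i.+1} | mdeg m == i]|)%N ->
  (forall i, hp`_i = \sum_(j < i.+1) ((1 - 'X) ^+ d)`_j * (H (i - j)%N)%:Z) ->
  (d <= n)%N -> (1 - 'X) ^+ (n - d) * hp = resolution_numerator E C.
Proof.
move=> H_eq hpE le_dn; apply/polyP => N.
pose F : {poly int} := \poly_(i < N.+1) (H i)%:Z.
have hpF i : (i <= N)%N -> hp`_i = ((1 - 'X) ^+ d * F)`_i.
  move=> le_iN; rewrite hpE coefM; apply: eq_bigr => j _.
  by rewrite coef_poly ltnS (leq_trans (leq_subr _ _)).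
have FS i : (i <= N)%N -> F`_i = (resolution_numerator E C * truncated_series N)`_i.
  move=> le_iN; rewrite coef_poly ltnS le_iN.
  have twist m (e : 'I_m -> nat) : (#|{: twist_index n e i}|%:Z : int)
      = (\sum_j 'X^(e j) * truncated_series N)`_i.
    rewrite card_twist_index coef_sum -natz natr_sum; apply: eq_bigr => j _.
    rewrite natz (card_twist_mdeg _ le_iN) coefXnM coef_truncated_series.
    by case: ifP.
  have := congr1 Posz (H_eq i); rewrite !PoszD !twist.
  rewrite (card_mdeg_eq (ltnSn i) le_iN) -coef_truncated_series.
  rewrite /resolution_numerator mulrDl mulrBl mul1r coefD coefB !mulr_suml => e.
  by apply: (addIr (\sum_j 'X^(E j) * truncated_series N)`_i); rewrite e; ring.
rewrite (coef_mull_congr (N := N) _ hpF) // mulrA -exprD subnK //.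
rewrite (coef_mull_congr (N := N) _ FS) // mulrCA.
rewrite (@coef_mull_congr N _ _ 1) ?mulr1 // => i le_iN.
by rewrite coef_truncated_inverse // coef1.
Qed.

End HilbertSeries.

(** * The h-polynomial of a determinantal ideal *)

Section DegreeData.
Variables (t : nat) (a b : nat -> int).

Definition diag_degree l := `|b l - a l|%N.
Definition superdiag_degree l := `|b l.+1 - a l|%N.
Definition left_degree j := (\sum_(0 <= l < j) diag_degree l)%N.
Definition right_degree j := (\sum_(j <= l < t) superdiag_degree l)%N.

(* Degrees of the maximal minors and of the syzygies given by the rows: the minor
   omitting column j has the degree of its main diagonal. *)
Definition minor_degree j := (left_degree j + right_degree j)%N.
Definition syzygy_degree l := (left_degree l.+1 + right_degree l)%N.

(** The l-th summand enumerates by degree a rectangle of exponents (x, y): x from [left_degree l] to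
    below [left_degree l.+1], and y below [right_degree l]. Together the rectangles form a
    staircase. *)
Definition h_formula : {poly int} :=
  \sum_(l < t) 'X^(left_degree l) *
    ((\sum_(u < diag_degree l) 'X^u) * (\sum_(v < right_degree l) 'X^v)).

Hypothesis b_gt_a : forall l, (l < t)%N -> a l < b l.
Hypothesis b_homo : forall l, (l < t)%N -> b l <= b l.+1.

Lemma diag_degreeE l : (l < t)%N -> (diag_degree l)%:Z = b l - a l.
Proof. by move=> /b_gt_a lt; rewrite /diag_degree gez0_abs // subr_ge0 ltW. Qed.

Lemma superdiag_degreeE l : (l < t)%N -> (superdiag_degree l)%:Z = b l.+1 - a l.
Proof.
move=> lt; rewrite /superdiag_degree gez0_abs // subr_ge0.
by apply: ltW; apply: lt_le_trans (b_gt_a lt) (b_homo lt).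
Qed.

Lemma left_degree0 : left_degree 0 = 0%N.
Proof. by rewrite /left_degree big_geq. Qed.

Lemma left_degreeS l : left_degree l.+1 = (left_degree l + diag_degree l)%N.
Proof. by rewrite /left_degree big_nat_recr. Qed.

Lemma right_degreeS l : (l < t)%N ->
  right_degree l = (superdiag_degree l + right_degree l.+1)%N.
Proof. by move=> lt; rewrite /right_degree big_ltn. Qed.

Lemma right_degree_max : right_degree t = 0%N.
Proof. by rewrite /right_degree big_geq. Qed.

(** Omitting column j subtracts b_j from the sum of all b minus the sum of all a, so E_j + b_j does
    not depend on j. *)
Lemma minor_degree_shift j : (j <= t)%N ->
  (minor_degree j)%:Z + b j = (minor_degree 0)%:Z + b 0%N.
Proof.
elim: j => [|j IH] // lt_jt; rewrite -IH 1?ltnW // /minor_degree.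
rewrite left_degreeS (right_degreeS lt_jt) !PoszD diag_degreeE // superdiag_degreeE //.
ring.
Qed.

Lemma syzygy_degreeE l j : (l < t)%N -> (j <= t)%N ->
  (syzygy_degree l)%:Z = (minor_degree j)%:Z + (b j - a l).
Proof.
move=> lt_lt le_jt; have := minor_degree_shift (ltnW lt_lt).
rewrite -(minor_degree_shift le_jt) /syzygy_degree left_degreeS /minor_degree.
rewrite !PoszD diag_degreeE // => e; rewrite [RHS]addrA -e; ring.
Qed.

Lemma minor_degree_bump j : (j <= t)%N ->
  (minor_degree j)%:Z = \sum_(l < t) (b (bump j l) - a l).
Proof.
move=> le_jt; rewrite -(big_mkord xpredT (fun l => b (bump j l) - a l)).
rewrite (big_cat_nat (n := j)) //= /minor_degree PoszD /left_degree /right_degree.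
rewrite -!natz !natr_sum; congr (_ + _); rewrite [LHS]big_nat_cond [RHS]big_nat_cond.
  apply: eq_bigr => l; rewrite andbT => /andP[_ lt_lj].
  by rewrite natz diag_degreeE ?(leq_trans lt_lj) // /bump leqNgt lt_lj.
apply: eq_bigr => l; rewrite andbT => /andP[le_jl lt_lt].
by rewrite natz superdiag_degreeE // /bump le_jl.
Qed.

Lemma left_degree_lt l m : (l < m <= t)%N -> (left_degree l < left_degree m)%N.
Proof.
case/andP=> lt_lm; elim: m lt_lm => // m IH; rewrite ltnS leq_eqVlt => /orP[/eqP->|lt] lt_mt.
  rewrite left_degreeS -[X in (X < _)%N]addn0 ltn_add2l -ltz_nat diag_degreeE //.
  by rewrite subr_gt0 b_gt_a.
by apply: leq_trans (IH lt (ltnW lt_mt)) _; rewrite left_degreeS leq_addr.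
Qed.

Lemma right_degree_gt0 l : (l < t)%N -> (0 < right_degree l)%N.
Proof.
move=> lt; rewrite right_degreeS // addn_gt0 -ltz_nat superdiag_degreeE // subr_gt0.
by rewrite (lt_le_trans (b_gt_a lt)) // b_homo.
Qed.

Lemma right_degree_le l m : (l <= m)%N -> (right_degree m <= right_degree l)%N.
Proof.
move=> le_lm; rewrite /right_degree; have [le_mt|lt_tm] := leqP m t.
  by rewrite [leqRHS](big_cat_nat (n := m)) //= leq_addl.
by rewrite big_geq // ltnW.
Qed.

(** The factor (1 - z)^2 reduces each rectangle to its four corners. Those on the x-axis telescope
    to 1 - z^(E_t), the others give the remaining E_l and all C_l. *)
Lemma resolution_numeratorE :
  resolution_numerator (fun j : 'I_t.+1 => minor_degree j)
    (fun l : 'I_t => syzygy_degree l) = (1 - 'X) ^+ 2 * h_formula.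
Proof.
rewrite /h_formula mulr_sumr.
transitivity (\sum_(l < t) (('X^(left_degree l) - 'X^(left_degree l.+1))
    - ('X^(minor_degree l) - 'X^(syzygy_degree l))) : {poly int}); last first.
  apply: eq_bigr => l _; rewrite expr2 mulrCA mulrACA !geometric_sum.
  rewrite /minor_degree /syzygy_degree left_degreeS !exprD; ring.
rewrite /resolution_numerator [X in 1 - X]big_ord_recr /= sumrB [X in _ = _ - X]sumrB.
rewrite -(big_mkord xpredT (fun l => 'X^(left_degree l) - 'X^(left_degree l.+1))).
rewrite (telescope_sumr_eq (fun l => - 'X^(left_degree l))) //; last first.
  by move=> l _; ring.
by rewrite /minor_degree right_degree_max addn0 left_degree0 expr0; ring.
Qed.

Lemma h_formula_at1 : (0 < t)%N -> 0 < h_formula.[1].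
Proof.
move=> t0; have geom m : (\sum_(u < m) 'X^u : {poly int}).[1] = m%:Z.
  rewrite horner_sum (eq_bigr (fun=> 1)) ?sumr_const ?card_ord ?natz //.
  by move=> u _; rewrite hornerXn expr1n.
rewrite /h_formula horner_sum (bigD1 (Ordinal t0)) //= ltr_wpDr //.
  by apply: sumr_ge0 => l _; rewrite !hornerM hornerXn expr1n mul1r !geom.
rewrite !hornerM hornerXn expr1n mul1r !geom mulr_gt0 ?ltz_nat ?right_degree_gt0 //.
by rewrite -ltz_nat diag_degreeE // subr_gt0 b_gt_a.
Qed.

Lemma minor_degree_ge j : (j <= t)%N -> (t <= minor_degree j)%N.
Proof.
move=> le_jt; rewrite /minor_degree.
have left m : (m <= t)%N -> (m <= left_degree m)%N.
  elim: m => // m IH lt; rewrite left_degreeS -addn1; apply: leq_add; first exact/IH/ltnW.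
  by rewrite lt0n absz_eq0 subr_eq0 gt_eqF // b_gt_a.
have right m : (m <= t)%N -> (m <= right_degree (t - m))%N.
  elim: m => // m IH lt; have lt' : (t - m.+1 < t)%N by lia.
  rewrite (right_degreeS lt') subnSK //.
  rewrite -add1n; apply: leq_add; last exact/IH/ltnW.
  by rewrite lt0n absz_eq0 subr_eq0 gt_eqF // (lt_le_trans (b_gt_a lt') (b_homo lt')).
by have := leq_add (left _ le_jt) (right _ (leq_subr j t)); rewrite subKn // subnKC.
Qed.

End DegreeData.

Section HomogeneousMatrix.
Variables (k : fieldType) (n : nat).
Local Notation S := {mpoly k[n]}.

Definition int_homog (z : int) (p : S) := p = 0 \/ exists2 d : nat, z = d%:Z & p \is d.-homog.

Lemma int_homog_prod (T : finType) (z : T -> int) (F : T -> S) :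
  (forall x, int_homog (z x) (F x)) -> int_homog (\sum_x z x) (\prod_x F x).
Proof.
move=> H; elim/big_rec2: _ => [|x p y _ IH].
  by right; exists 0%N => //; rewrite -mpolyC1; apply: dhomog1.
case: (H x) IH => [->|[d -> hd]]; first by left; rewrite mul0r.
case=> [->|[e -> he]]; first by left; rewrite mulr0.
by right; exists (d + e)%N; rewrite ?PoszD //; apply: dhomogM.
Qed.

Lemma int_homog_nat (d : nat) p : int_homog d%:Z p -> p \is d.-homog.
Proof. by case=> [->|[e [->]]] //; apply: rpred0. Qed.

(** All Leibniz terms have the same degree, as permuting the columns does not change the sum of the
    b. A term with an entry of negative degree vanishes, since that entry is 0. *)
Lemma det_homog t (N : 'M[S]_t) (a b : 'I_t -> int) (d : nat) :
  (forall i j, int_homog (b j - a i) (N i j)) -> d%:Z = \sum_i (b i - a i) ->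
  \det N \is d.-homog.
Proof.
move=> hN ed; apply: rpred_sum => s _; rewrite mulr_sign -[X in if _ then X else _]scaleN1r.
suff h : \prod_i N i (s i) \is d.-homog by case: ifP => // _; apply: rpredZ.
apply: int_homog_nat.
have -> : d%:Z = \sum_i (b (s i) - a i).
  by rewrite ed !sumrB (reindex_inj (@perm_inj _ s)).
by apply: int_homog_prod => i; apply: hN.
Qed.

End HomogeneousMatrix.

(** Allows maximal minors to be indexed by the omitted column: [f] misses some [j], and a strictly
    increasing self-map of 'I_t is the identity. *)
Lemma increasing_ord_lift t (f : 'I_t -> 'I_t.+1) :
  {homo f : i j / (i < j)%N} -> exists j : 'I_t.+1, f =1 lift j.
Proof.
move=> f_incr.
have f_inj : injective f.
  move=> x y e; apply: val_inj; case: (ltngtP x y) => // /f_incr; by rewrite e ltnn.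
have [j jP] : exists j : 'I_t.+1, j \notin codom f.
  apply: NNPP => nex; have : (#|'I_t.+1| <= #|codom f|)%N.
    apply: subset_leq_card; apply/subsetP => j _.
    by apply: contraT => jP; case: nex; exists j.
  by rewrite card_codom // !card_ord ltnn.
have /fin_all_exists [g gP] : forall i, exists l, f i = lift j l.
  move=> i; case: (unliftP j (f i)) => [l ->|e]; first by exists l.
  by move: jP; rewrite -e codom_f.
have g_incr : {homo g : x y / (x < y)%N}.
  move=> x y lt; have := f_incr _ _ lt; rewrite !gP /= !/bump.
  by do 2!case: leqP; lia.
have ge (i : 'I_t) : (i <= g i)%N.
  case: i => m; elim: m => // m IH lt.
  by apply: leq_ltn_trans (IH (ltnW lt)) _; apply: g_incr.
have le m (i : 'I_t) : (t - i)%N = m -> (g i <= i)%N.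
  elim: m i => [|m IH] i em; first by move: (ltn_ord i); lia.
  have [lt|] := ltnP i.+1 t; last by move: (ltn_ord (g i)) (ltn_ord i); lia.
  have /= := IH (Ordinal lt) _.
  have /= := g_incr i (Ordinal lt) (ltnSn i); lia.
exists j => i; rewrite gP; congr lift; apply: val_inj; apply/eqP.
by rewrite eqn_leq ge (le _ _ erefl).
Qed.

Section DeterminantalHPolynomial.
Variables (k : fieldType) (n t : nat).
Local Notation S := {mpoly k[n.+1]}.
Variables (M : 'M[S]_(t, t.+1)) (I : S -> Prop) (a b : nat -> int).
Hypothesis I_max : forall p, I p <-> ideal_max M p.

Lemma ideal_max_signed_minors p :
  I p <-> exists c : 'I_t.+1 -> S, p = \sum_j c j * signed_minor M j.
Proof.
rewrite I_max; split=> [[m [c [g [gM ->]]]]|[c ->]]; last first.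
  exists t.+1, (fun j => c j * (-1) ^+ j), (fun j => \det (col' j M)); split.
    move=> j; exists (lift j) => // x y lt; rewrite /= /bump.
    by do 2!case: leqP; lia.
  by apply: eq_bigr => j _; rewrite mulrA.
have gj i : exists j : 'I_t.+1, g i = (-1) ^+ j * signed_minor M j.
  have [f f_incr ->] := gM i; have [j fj] := increasing_ord_lift f_incr.
  exists j; rewrite /signed_minor mulrA -expr2 sqrr_sign mul1r; congr (\det _).
  by apply/matrixP => x y; rewrite !mxE fj.
have [j ej] := fin_all_exists gj.
exists (fun l => \sum_(i | j i == l) c i * (-1) ^+ l).
rewrite (partition_big j xpredT) //=; apply: eq_bigr => l _.
by rewrite mulr_suml; apply: eq_bigr => i /eqP <-; rewrite ej mulrA.
Qed.

Hypothesis t_gt0 : (0 < t)%N.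
Hypothesis M_homog : forall (i : 'I_t) (j : 'I_t.+1), int_homog (b j - a i) (M i j).
Hypothesis b_gt_a : forall l, (l < t)%N -> a l < b l.
Hypothesis b_homo : forall l, (l < t)%N -> b l <= b l.+1.
Hypothesis I_height : height_ge I 2.

Let E (j : 'I_t.+1) := minor_degree t a b j.
Let C (l : 'I_t) := syzygy_degree t a b l.

Lemma signed_minor_homog j : signed_minor M j \is (E j).-homog.
Proof.
suff h : \det (col' j M) \is (E j).-homog.
  rewrite /signed_minor -signr_odd mulr_sign; case: ifP => // _.
  by rewrite -scaleN1r; apply: rpredZ.
apply: (det_homog (a := fun i : 'I_t => a i) (b := fun l : 'I_t => b (lift j l))).
  by move=> i l; rewrite mxE; apply: M_homog.
by rewrite /E (minor_degree_bump b_gt_a b_homo) // -ltnS.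
Qed.

Lemma entry_twist_homog l j :
  M l j = 0 \/ exists2 d, (E j + d = C l)%N & M l j \is d.-homog.
Proof.
case: (M_homog l j) => [->|[d ed hd]]; [by left | right; exists d => //].
have le_jt : (j <= t)%N by rewrite -ltnS.
have := syzygy_degreeE b_gt_a b_homo (ltn_ord l) le_jt.
by rewrite ed -PoszD => -[/esym].
Qed.

Lemma signed_minor_det0 j : (signed_minor M j == 0) = (\det (col' j M) == 0).
Proof. by rewrite /signed_minor mulf_eq0 signr_eq0. Qed.

Lemma minor_neq0 : exists j, \det (col' j M) != 0.
Proof.
have [x /ideal_max_signed_minors [c ->] nz] := height_ge2_nonzero I_height.
apply: NNPP => nex; case/negP: nz; apply/eqP; rewrite big1 // => j _.
apply/eqP; rewrite mulf_eq0 signed_minor_det0; apply/orP; right.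
by apply: contraT => nz; case: nex; exists j.
Qed.

Lemma minors_coprime p : prime_elt p -> ~ forall j, divides p (\det (col' j M)).
Proof.
move=> pp H; apply: (height_ge2_no_prime_divisor I_height pp) => x.
case/ideal_max_signed_minors => c ->; elim/big_rec: _; first exact: divides0.
by move=> j y _; apply: dividesD; do 2!apply: divides_mull.
Qed.

Lemma determinantal_h_polynomial hp : is_h_polynomial I hp -> hp = h_formula t a b.
Proof.
move=> [H [d [H_val [I_dim _] hpE]]].
have le_d : (d.+2 <= n.+1)%N := quotient_dim_of_height_ge2 I_height I_dim.
have [j0 d0] := minor_neq0.
have H_eq i : (H i + #|{: twist_index n.+1 E i}|
    = #|{: twist_index n.+1 C i}| + #|[pred m : 'X_{1..n.+1 < i.+1} | mdeg m == i]|)%N.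
  apply: (card_hilbert_value (M := M) (I := I)) => //.
  - exact: entry_twist_homog.
  - exact: signed_minor_homog.
  - by move=> w; apply: mulmx_injective_of_minor d0.
  - apply: hilbert_burch_exact; [exact: factorial_domain_mpoly | by exists j0 |].
    exact: minors_coprime.
  - exact: ideal_max_signed_minors.
have := hilbert_numerator H_eq hpE (ltnW (ltnW le_d)).
rewrite resolution_numeratorE.
have [e ->] : exists e, (n.+1 - d = 2 + e)%N by exists (n.+1 - d - 2)%N; lia.
have X1 : 1 - 'X != 0 :> {poly int}.
  by rewrite -opprB oppr_eq0 -polyC1 polyXsubC_eq0.
rewrite exprD -mulrA => /(mulfI (expf_neq0 2 X1)).
(* A dimension smaller than n - 1 would leave a factor 1 - z in [h_formula], against its positive
   value at 1. *)
case: e => [|e e1]; first by rewrite expr0 mul1r.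
have := h_formula_at1 b_gt_a b_homo t_gt0.
have X1_root : (1 - 'X : {poly int}).[1] = 0 by rewrite hornerD hornerN hornerX hornerC subrr.
by rewrite -e1 exprS -mulrA hornerM X1_root mul0r ltxx.
Qed.

End DeterminantalHPolynomial.

(** * Pure order ideals *)

Section PureOrderIdeals.
Variable r : nat.
Implicit Types (G : {fset 'X_{1..r}}) (m : 'X_{1..r}).

Definition degree_count G i := count (fun m => mdeg m == i) (enum_fset G).

Definition max_mdeg G := (\max_(m <- enum_fset G) mdeg m)%N.

Lemma mdeg_le_max G m : m \in G -> (mdeg m <= max_mdeg G)%N.
Proof. by move=> mG; apply: leq_bigmax_seq. Qed.

Lemma nth_f_vector G i : nth 0 [seq Posz x | x <- f_vector G] i = (degree_count G i)%:Z.
Proof.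
have sz : size (f_vector G) = (max_mdeg G).+1 by rewrite size_mkseq.
have [le_i|lt_i] := leqP i (max_mdeg G).
  by rewrite (nth_map 0%N) ?sz ?ltnS // nth_mkseq ?ltnS.
rewrite nth_default; last by rewrite size_map sz.
suff -> : degree_count G i = 0%N by [].
apply/eqP; rewrite -leqn0 leqNgt -has_count; apply/hasPn => m mG; rewrite neq_ltn.
by rewrite (leq_ltn_trans (mdeg_le_max mG)).
Qed.

Lemma max_mdeg_attained G : G != fset0 -> exists2 m, m \in G & mdeg m = max_mdeg G.
Proof.
case/fset0Pn => m0 m0G; apply: NNPP => nex.
suff : (max_mdeg G < max_mdeg G)%N by rewrite ltnn.
rewrite {1}/max_mdeg big_seq; elim/big_rec: _ => [|m d mG IH].
  apply: leq_ltn_trans (leq0n (mdeg m0)) _; rewrite ltn_neqAle mdeg_le_max // andbT.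
  by apply/eqP => e; apply: nex; exists m0.
rewrite gtn_max IH andbT ltn_neqAle mdeg_le_max // andbT.
by apply/eqP => e; apply: nex; exists m.
Qed.

(** The top degree is attained, so the f-vector has no trailing zero and is a normalized coefficient
    list. *)
Lemma polyseq_f_vector G (p : {poly int}) : G != fset0 ->
  (forall i, p`_i = (degree_count G i)%:Z) -> polyseq p = [seq Posz x | x <- f_vector G].
Proof.
move=> G0 pE; set v := map _ _.
have v0 : last 1 v != 0.
  have -> : last 1 v = (degree_count G (max_mdeg G))%:Z.
    by rewrite -nth_f_vector -/v (last_nth 0) /v size_map size_mkseq.
  have [m mG <-] := max_mdeg_attained G0.
  by rewrite eqz_nat -lt0n -has_count; apply/hasP; exists m.
rewrite -[RHS](PolyK v0); congr polyseq; apply/polyP => i.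
by rewrite coef_Poly nth_f_vector.
Qed.

(** Below the top degree [m] is not maximal; a proper multiple in [G] exceeds it in some variable,
    and closure under division brings that multiple down to a single extra factor. *)
Lemma pure_extension G m : order_ideal G -> pure G -> m \in G ->
  (mdeg m < max_mdeg G)%N -> exists i, (m + U_(i))%MM \in G.
Proof.
move=> ordG pureG mG lt_m; apply: NNPP => nex.
have G0 : G != fset0 by apply/fset0Pn; exists m.
have [m0 m0G e0] := max_mdeg_attained G0.
have eq_of_le (m1 m2 : 'X_{1..r}) : (m1 <= m2)%MM -> (mdeg m2 <= mdeg m1)%N -> m2 = m1.
  move=> le12; have <- := submK le12; rewrite mdegD -[X in (_ <= X)%N]add0n leq_add2r leqn0.
  by rewrite mdeg_eq0 => /eqP ->; rewrite add0m.
have max0 : maximal_in G m0.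
  split=> // m' m'G le; apply: eq_of_le => //; rewrite e0; exact: mdeg_le_max.
have maxm : maximal_in G m.
  split=> // m' m'G le; apply: NNPP => ne.
  have [i lt_i] : exists i, (m i < m' i)%N.
    apply: NNPP => nlt; apply: ne; apply/mnmP => i; apply/eqP; rewrite eqn_leq.
    rewrite (mnm_lepP le i) andbT leqNgt; apply/negP => lt; by apply: nlt; exists i.
  apply: nex; exists i; apply: ordG m'G _; apply/mnm_lepP => j.
  rewrite mnmDE mnm1E; case: eqP => [<-|_]; first by rewrite addn1.
  by rewrite addn0; apply: (mnm_lepP le).
by move: lt_m; rewrite (pureG _ _ maxm max0) e0 ltnn.
Qed.

End PureOrderIdeals.

(** * Pure order ideals with exactly two variables, in an ambient ring that may have more *)

Section TwoVariables.
Variables (r : nat) (G : {fset 'X_{1..r}}).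
Hypotheses (G_order : order_ideal G) (G_pure : pure G).
Local Notation s := (max_mdeg G).

Lemma two_variables : degree_count G 1 = 2%N -> exists i1 i2, i1 != i2 /\
  (forall i, (U_(i)%MM \in G) = (i == i1) || (i == i2)).
Proof.
rewrite /degree_count -size_filter.
case E: (filter _ _) => [|m1 [|m2 [|//]]] //= _.
have F m : (m \in G) && (mdeg m == 1%N) = (m == m1) || (m == m2).
  by rewrite andbC -[_ && _](mem_filter (fun m => mdeg m == 1%N)) E !inE.
have /andP[_ /mdeg1P[i1 /eqP e1]] : (m1 \in G) && (mdeg m1 == 1%N) by rewrite F eqxx.
have /andP[_ /mdeg1P[i2 /eqP e2]] : (m2 \in G) && (mdeg m2 == 1%N) by rewrite F eqxx orbT.
have U_inj (i j : 'I_r) : (U_(i)%MM == U_(j)%MM :> 'X_{1..r}) = (i == j).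
  apply/eqP/eqP => [/mnmP /(_ i)|->//]; rewrite !mnm1E eqxx.
  by case: eqP => // ->.
have : uniq (filter (fun m => mdeg m == 1%N) (enum_fset G)) by rewrite filter_uniq ?fset_uniq.
rewrite E /= inE andbT e1 e2 U_inj => ne.
exists i1, i2; split=> // i.
by rewrite -[LHS]andbT -[true](eqxx (mdeg (U_(i) : 'X_{1..r}))) {2}mdeg1 F e1 e2 !U_inj.
Qed.

Variables i1 i2 : 'I_r.
Hypothesis i12 : i1 != i2.
Hypothesis varsE : forall i, (U_(i)%MM \in G) = (i == i1) || (i == i2).

Definition two_monomial x y : 'X_{1..r} := (U_(i1) *+ x + U_(i2) *+ y)%MM.

Lemma two_monomial_in m : m \in G -> m = two_monomial (m i1) (m i2).
Proof.
move=> mG; apply/mnmP => i; rewrite mnmDE !mulmnE !mnm1E.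
have [<-|n1] := eqVneq i1 i; first by rewrite eq_sym (negbTE i12) mul1n mul0n addn0.
have [<-|n2] := eqVneq i2 i; first by rewrite mul0n mul1n.
rewrite !mul0n; apply/eqP; apply: contraT; rewrite -lep1mP => le.
by have := G_order mG le; rewrite varsE ![i == _]eq_sym (negbTE n1) (negbTE n2).
Qed.

Lemma two_monomial1 x y : two_monomial x y i1 = x.
Proof. by rewrite mnmDE !mulmnE !mnm1E eqxx eq_sym (negbTE i12) mul1n mul0n addn0. Qed.

Lemma mdeg_two_monomial x y : mdeg (two_monomial x y) = (x + y)%N.
Proof. by rewrite mdegD !mdegMn !mdeg1 !mul1n. Qed.

Definition shape x y := two_monomial x y \in G.

Lemma shape_le x y x' y' : (x' <= x)%N -> (y' <= y)%N -> shape x y -> shape x' y'.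
Proof.
move=> lex ley xy; apply: G_order xy _; apply/mnm_lepP => i.
by rewrite !mnmDE !mulmnE leq_add // leq_mul.
Qed.

Lemma shape_extension x y : (x + y < s)%N -> shape x y -> shape x.+1 y || shape x y.+1.
Proof.
move=> lt xy; have [|i iG] := pure_extension G_order G_pure xy.
  by rewrite mdeg_two_monomial.
have : (i == i1) || (i == i2).
  by rewrite -varsE; apply: G_order iG _; apply: lem_addl.
rewrite /shape /two_monomial; case/orP=> /eqP e; apply/orP; [left|right];
  move: iG; rewrite e /two_monomial; congr (_ \in G); apply/mnmP => j;
  by rewrite !(mnmDE, mulmnE); lia.
Qed.

Lemma degree_count_shape i : degree_count G i = (\sum_(x < i.+1) shape x (i - x))%N.
Proof.
rewrite /degree_count -size_filter.
have -> : (\sum_(x < i.+1) shape x (i - x))%N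
    = size [seq two_monomial x (i - x) | x <- iota 0 i.+1 & shape x (i - x)].
  rewrite size_map size_filter -sum1_count [RHS]big_mkcond.
  rewrite -[X in iota _ X]subn0 -/(index_iota 0 i.+1) big_mkord.
  by apply: eq_bigr => x _; case: ifP.
apply: perm_size; apply: uniq_perm; first by rewrite filter_uniq ?fset_uniq.
  rewrite map_inj_in_uniq ?filter_uniq ?iota_uniq // => x y _ _ e.
  by have := two_monomial1 x (i - x); rewrite e two_monomial1.
move=> m; rewrite mem_filter; apply/andP/mapP => [[/eqP em mG]|[x]].
  have em' := two_monomial_in mG.
  have di : (m i1 + m i2)%N = i by rewrite -em {3}em' mdeg_two_monomial.
  have e2 : (i - m i1)%N = m i2 by rewrite -di addKn.
  exists (m i1); rewrite ?e2 // mem_filter e2 /shape -em' mG mem_iota /=.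
  by rewrite add0n ltnS -di leq_addr.
rewrite mem_filter mem_iota add0n ltnS => /andP[xG /andP[_ le_x]] ->.
by rewrite mdeg_two_monomial subnKC.
Qed.

(* The second difference of the Hilbert function is the sum, over the monomials of
   degree i + 2, of the mixed second differences of the indicator function of G;
   purity makes each of them nonpositive. *)
Lemma second_difference_le0 i : (i < s)%N ->
  (degree_count G i.+2 + degree_count G i <= degree_count G i.+1 + degree_count G i.+1)%N.
Proof.
move=> lt_is; rewrite !degree_count_shape.
(* Once the axis terms are split off, the four sums run over the unit squares with corners (x, y),
   (x+1, y), (x, y+1), (x+1, y+1), where y = i - x. The axis terms compare by closure under
   division. *)
rewrite [X in (X + _ <= _)%N]big_ord_recl big_ord_recr /= subnn subn0.
rewrite [X in (_ <= X + _)%N]big_ord_recl [X in (_ <= _ + X)%N]big_ord_recr /= subnn subn0.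
have [h1 h2] : (shape 0 i.+2 <= shape 0 i.+1)%N /\ (shape i.+2 0 <= shape i.+1 0)%N.
  by split; case E: (shape _ _) => //; rewrite (shape_le _ _ E).
suff : (\sum_(x < i.+1) shape (bump 0 x) (i.+2 - bump 0 x) + \sum_(x < i.+1) shape x (i - x)
  <= \sum_(x < i.+1) shape (bump 0 x) (i.+1 - bump 0 x) + \sum_(x < i.+1) shape x (i.+1 - x))%N.
  move: h1 h2; rewrite /bump /=.
  move: (\sum_(x < i.+1) _)%N (\sum_(x < i.+1) _)%N (\sum_(x < i.+1) _)%N (\sum_(x < i.+1) _)%N.
  by move: (nat_of_bool _) (nat_of_bool _) (nat_of_bool _) (nat_of_bool _) => *; lia.
rewrite -!big_split /=; apply: leq_sum => x _; rewrite /bump /= !add1n !subSS.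
have le_x : (x <= i)%N by rewrite -ltnS.
rewrite subSn //; set y := (i - x)%N.
have imp1 : shape x.+1 y.+1 -> shape x.+1 y by apply: shape_le.
have imp2 : shape x.+1 y.+1 -> shape x y.+1 by apply: shape_le.
have imp3 : shape x y -> shape x.+1 y || shape x y.+1.
  by apply: shape_extension; rewrite subnKC.
case: (shape x.+1 y.+1) imp1 imp2 => [/(_ isT) -> /(_ isT) ->|_ _]; first by case: (shape x y).
by case: (shape x y) imp3 => [/(_ isT)|_] //; case: (shape x.+1 y); case: (shape x y.+1).
Qed.

End TwoVariables.

Lemma coef_mul_sqr1subX (p : {poly int}) i :
  ((1 - 'X) ^+ 2 * p)`_i.+2 = p`_i.+2 - (p`_i.+1 + p`_i.+1) + p`_i.
Proof.
have -> : (1 - 'X) ^+ 2 * p = p - (p * 'X + p * 'X) + p * 'X * 'X by ring.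
by rewrite !(coefD, coefN, coefMX) /=.
Qed.

Lemma coef_sum_Xn (T : finType) (F : T -> nat) i :
  (\sum_x 'X^(F x) : {poly int})`_i = #|[pred x | F x == i]|%:Z.
Proof.
rewrite coef_sum -sum1_card -natz natr_sum [RHS]big_mkcond.
by apply: eq_bigr => x _; rewrite coefXn eq_sym inE; case: eqP.
Qed.

(** * Purity forces equal syzygy degrees *)

Section PureToLevel.
Variables (t : nat) (E : 'I_t.+1 -> nat) (C : 'I_t -> nat) (hp : {poly int}).
Hypothesis hp_num : resolution_numerator E C = (1 - 'X) ^+ 2 * hp.
Hypotheses (E_gt1 : forall j, (1 < E j)%N) (C_gt1 : forall l, (1 < C l)%N).
Hypothesis EC_neq : forall j l, E j != C l.

Lemma coef_resolution_numerator i : (resolution_numerator E C)`_i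
  = (i == 0%N)%:R - #|[pred j | E j == i]|%:Z + #|[pred l | C l == i]|%:Z.
Proof. by rewrite coefD coefB coef1 !coef_sum_Xn. Qed.

Lemma coef_resolution_numerator_small i : (i <= 1)%N ->
  (resolution_numerator E C)`_i = (i == 0%N)%:R.
Proof.
move=> le_i1; rewrite coef_resolution_numerator !eq_card0 ?subr0 ?addr0 // => x;
  rewrite !inE; apply/negbTE; rewrite neq_ltn orbC (leq_ltn_trans le_i1) //.
Qed.

Lemma syzygy_degree_of_pure l : pure_O_sequence (polyseq hp) ->
  C l = (size hp).+1.
Proof.
move=> [r [G [G0 G_order G_pure e]]].
have hpE i : hp`_i = (degree_count G i)%:Z by rewrite e nth_f_vector.
have sz : size hp = (max_mdeg G).+1 by rewrite e size_map size_mkseq.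
have expand : (1 - 'X) ^+ 2 * hp = hp - (hp * 'X + hp * 'X) + hp * 'X * 'X by ring.
(* All E_j and C_l exceed 1, so the numerator is 1 + 0 z + ...; dividing by (1 - z)^2 gives h_0 = 1
   and h_1 = 2. *)
have h0 : hp`_0 = 1.
  have := coef_resolution_numerator_small (leqnSn 0).
  by rewrite hp_num expand !(coefD, coefN, coefMX) /= => e0; rewrite -[RHS]e0; ring.
have h1 : hp`_1 = 2.
  have := coef_resolution_numerator_small (leqnn 1).
  rewrite hp_num expand !(coefD, coefN, coefMX) /= h0 => e1.
  by apply/eqP; rewrite -subr_eq0; apply/eqP; rewrite -[RHS]e1; ring.
have two_vars : degree_count G 1 = 2%N by move: h1; rewrite hpE => -[].
have [i1 [i2 [i12 varsE]]] := two_variables two_vars.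
have pos : 0 < (resolution_numerator E C)`_(C l).
  have no_E : #|[pred j | E j == C l]| = 0%N.
    by apply: eq_card0 => j; rewrite !inE; apply/negbTE.
  have some_C : (0 < #|[pred l' | C l' == C l]|)%N.
    by apply/card_gt0P; exists l; rewrite inE.
  by rewrite coef_resolution_numerator no_E (gtn_eqF (ltnW (C_gt1 l))) !add0r ltz_nat.
move: pos; rewrite hp_num; move: (C_gt1 l); case: (C l) => [|[|i]] // _.
rewrite coef_mul_sqr1subX !hpE sz => pos; congr _.+2; apply/eqP; rewrite eqn_leq.
(* Beyond degree s + 2 the coefficient is 0; in degrees 2 to s + 1 it is a second difference,
   nonpositive by purity. Neither is compatible with [pos]. *)
apply/andP; split; rewrite leqNgt; apply/negP => lt.
  move: pos; rewrite -!hpE !nth_default ?sz //; lia.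
have := @second_difference_le0 _ _ G_order G_pure _ _ i12 varsE _ lt.
by move: pos; lia.
Qed.

End PureToLevel.

(** * The staircase order ideal realizing h *)

Section LevelToPure.
Variables (t : nat) (a b : nat -> int).
Hypothesis t_gt0 : (0 < t)%N.
Hypothesis b_gt_a : forall l, (l < t)%N -> a l < b l.
Hypothesis b_homo : forall l, (l < t)%N -> b l <= b l.+1.
Local Notation P := (left_degree a b).
Local Notation Q := (right_degree t a b).

Definition plane_monomial x y : 'X_{1..2} := [multinom (if i == ord0 then x else y) | i < 2].

Lemma plane_monomialE (m : 'X_{1..2}) : m = plane_monomial (m ord0) (m ord_max).
Proof.
apply/mnmP => i; rewrite mnmE; case: eqP => [->|/eqP ne] //.
by congr (m _); apply: val_inj; case: i ne => [[|[|]]].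
Qed.

Lemma plane_monomial0 x y : plane_monomial x y ord0 = x.
Proof. by rewrite mnmE. Qed.

Lemma plane_monomial1 x y : plane_monomial x y ord_max = y.
Proof. by rewrite mnmE. Qed.

Lemma mdeg_plane_monomial x y : mdeg (plane_monomial x y) = (x + y)%N.
Proof. by rewrite mdegE !big_ord_recl big_ord0 !mnmE /= addn0. Qed.

(* The monomials outside the ideal of maximal minors of the bidiagonal matrix with
   diagonal entries x^(b_l - a_l) and superdiagonal entries y^(b_(l+1) - a_l); the
   columns of the staircase are grouped into blocks indexed by l. *)
Definition staircase_seq : seq 'X_{1..2} :=
  [seq plane_monomial (P l + uv.1) uv.2 | l <- iota 0 t,
     uv <- [seq (u, v) | u <- iota 0 (diag_degree a b l), v <- iota 0 (Q l)]].

Definition staircase : {fset 'X_{1..2}} := seq_fset tt staircase_seq.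

(** The lower bound on x in a block may be dropped: a point further left lies in an earlier block,
    whose columns are at least as tall. *)
Lemma staircaseP (m : 'X_{1..2}) : reflect
  (exists l, [/\ (l < t)%N, (m ord0 < P l.+1)%N & (m ord_max < Q l)%N]) (m \in staircase).
Proof.
rewrite seq_fsetE; apply: (iffP allpairsPdep) => [[l [[u v] []]]|[l [lt_lt]]].
  rewrite mem_iota add0n => lt_lt /allpairsP[[u' v'] /= [+ + [-> ->]]].
  rewrite !mem_iota !add0n => lt_u lt_v ->; exists l.
  by rewrite plane_monomial0 plane_monomial1 left_degreeS ltn_add2l.
elim: l lt_lt => [|l IH] lt_lt lt_x lt_y.
  exists 0%N, (m ord0, m ord_max); split; rewrite ?mem_iota ?left_degree0 -?plane_monomialE //.
  apply/allpairsP; exists (m ord0, m ord_max); rewrite !mem_iota !add0n /=; split=> //.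
  by move: lt_x; rewrite left_degreeS left_degree0.
have [lt|le] := ltnP (m ord0) (P l.+1).
  by apply: IH; rewrite ?(ltnW lt_lt) // (leq_trans lt_y) // right_degree_le.
exists l.+1, (m ord0 - P l.+1, m ord_max)%N; split.
- by rewrite mem_iota.
- apply/allpairsP; exists (m ord0 - P l.+1, m ord_max)%N; rewrite !mem_iota !add0n /=.
  by split=> //; rewrite ltn_subLR // -left_degreeS.
- by rewrite /= subnKC // -plane_monomialE.
Qed.

Lemma uniq_staircase_seq : uniq staircase_seq.
Proof.
apply: allpairs_uniq_dep; first exact: iota_uniq.
  move=> l _; apply: allpairs_uniq; rewrite ?iota_uniq //.
  by move=> [u v] [u' v'].
move=> [l [u v]] [l' [u' v']] /allpairsPdep[x [[y z] [xt yz ->]]].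
move=> /allpairsPdep[x' [[y' z'] [xt' yz' ->]]] /= e.
have uy : (y < diag_degree a b x)%N.
  by have /allpairsP[[? ?] /= [+ _ [-> _]]] := yz; rewrite mem_iota.
have uy' : (y' < diag_degree a b x')%N.
  by have /allpairsP[[? ?] /= [+ _ [-> _]]] := yz'; rewrite mem_iota.
move: xt xt'; rewrite !mem_iota !add0n => xt xt'.
have ex : (P x + y = P x' + y')%N.
  by have := plane_monomial0 (P x + y) z; rewrite e plane_monomial0.
have ez : z = z' by have := plane_monomial1 (P x + y) z; rewrite e plane_monomial1.
have mono (i j : nat) : (i < j)%N -> (j < t)%N -> (P i.+1 <= P j)%N.
  rewrite leq_eqVlt => /orP[/eqP->//|lt] ltj; apply/ltnW/left_degree_lt => //.
  exact: b_gt_a.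
  by rewrite lt ltnW.
have exx : x = x'.
  case: (ltngtP x x') => // lt.
    by have := mono _ _ lt xt'; rewrite left_degreeS; lia.
  by have := mono _ _ lt xt; rewrite left_degreeS; lia.
by subst x' z'; have -> : y = y' by lia.
Qed.

Lemma h_formula_coef i : (h_formula t a b)`_i = (degree_count staircase i)%:Z.
Proof.
have -> : degree_count staircase i = count (fun m => mdeg m == i) staircase_seq.
  apply/seq.permP; apply: uniq_perm; rewrite ?fset_uniq ?uniq_staircase_seq //.
  by move=> m; rewrite seq_fsetE.
suff -> : h_formula t a b = \sum_(m <- staircase_seq) 'X^(mdeg m).
  rewrite coef_sum -sum1_count -natz natr_sum [RHS]big_mkcond.
  by apply: eq_bigr => m _; rewrite coefXn eq_sym; case: eqP.
rewrite /staircase_seq big_allpairs_dep /= -[X in iota 0 X]subn0 big_mkord.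
apply: eq_bigr => l _; rewrite big_allpairs_dep /=.
rewrite -[X in _ = \sum_(u <- iota 0 X) _]subn0 big_mkord mulr_suml mulr_sumr.
apply: eq_bigr => u _; rewrite -[X in _ = \sum_(v <- iota 0 X) _]subn0 big_mkord mulrA mulr_sumr.
by apply: eq_bigr => v _; rewrite mdeg_plane_monomial /= -!exprD.
Qed.

Lemma staircase_order_ideal : order_ideal staircase.
Proof.
move=> m m' /staircaseP[l [lt lt0 lt1]] /mnm_lepP le; apply/staircaseP; exists l.
by split=> //; apply: leq_ltn_trans (le _) _.
Qed.

Lemma staircase_neq0 : staircase != fset0.
Proof.
apply/fset0Pn; exists (plane_monomial 0 0); apply/staircaseP; exists 0%N.
rewrite plane_monomial0 plane_monomial1; split=> //.
  have lt01 : (0 < 1 <= t)%N by [].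
  exact: leq_ltn_trans (leq0n _) (left_degree_lt b_gt_a lt01).
exact: right_degree_gt0.
Qed.

Lemma staircase_pure : (forall l, (l < t)%N -> a l = a 0%N) -> pure staircase.
Proof.
move=> a_const.
have corner m : maximal_in staircase m -> (mdeg m).+2 = syzygy_degree t a b 0.
  move=> [/staircaseP[l [lt lt0 lt1]] maxm].
  have <- : syzygy_degree t a b l = syzygy_degree t a b 0.
    apply/eqP; rewrite -eqz_nat.
    rewrite (syzygy_degreeE (j := 0) b_gt_a b_homo lt) //.
    by rewrite (syzygy_degreeE (j := 0) b_gt_a b_homo t_gt0) // a_const.
  (* The outer corner of the region containing [m] is in the staircase and divisible by [m], so
     maximality makes them equal. *)
  have <- : plane_monomial (P l.+1).-1 (Q l).-1 = m.
    apply: maxm.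
      apply/staircaseP; exists l; rewrite plane_monomial0 plane_monomial1.
      by split=> //; lia.
    apply/mnm_lepP => i; rewrite mnmE; case: eqP => [->|/eqP ne]; first by lia.
    have -> : i = ord_max by apply: val_inj; case: i ne => [[|[|]]].
    by lia.
  by rewrite mdeg_plane_monomial /syzygy_degree; lia.
by move=> m m' /corner e /corner; rewrite -e => -[].
Qed.

Lemma pure_O_sequence_h_formula : (forall l, (l < t)%N -> a l = a 0%N) ->
  pure_O_sequence (polyseq (h_formula t a b)).
Proof.
move=> a_const; exists 2%N, staircase; split.
- exact: staircase_neq0.
- exact: staircase_order_ideal.
- exact: staircase_pure.
- by apply: polyseq_f_vector; [exact: staircase_neq0 | exact: h_formula_coef].
Qed.

End LevelToPure.

(** * The equivalence for degree sequences a and b *)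

Lemma pure_O_sequence_determinantal (k : fieldType) (n t m : nat)
    (M : 'M[{mpoly k[n.+1]}]_(t, m)) (a : 'I_t -> int) (b : 'I_m -> int)
    (I : {mpoly k[n.+1]} -> Prop) (hp : {poly int}) :
  m = t.+1 -> (0 < t)%N -> homogeneous_of_degrees M a b ->
  (forall p, I p <-> ideal_max M p) ->
  {homo b : i j / (i <= j)%N >-> i <= j} ->
  (forall (i : 'I_t) (j : 'I_m), i = j :> nat -> a i < b j) ->
  (forall i j, b j != a i) ->
  height_ge I 2 -> is_h_polynomial I hp ->
  pure_O_sequence (polyseq hp) <-> (forall i1 i2, a i1 = a i2).
Proof.
move=> em; subst m; case: t M a b => // t M a b t_gt0 M_homog I_max b_mono diag ba_neq I_ht hpP.
(* The degree lemmas index by natural numbers; [inord] extends [a] and [b], with irrelevant values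
   out of range. *)
pose a' l := a (inord l); pose b' l := b (inord l).
have aE (i : 'I_t.+1) : a' i = a i by rewrite /a' inord_val.
have bE (j : 'I_t.+2) : b' j = b j by rewrite /b' inord_val.
have b_gt_a l : (l < t.+1)%N -> a' l < b' l.
  by move=> lt; apply: diag; rewrite !inordK // ltnW.
have b_homo l : (l < t.+1)%N -> b' l <= b' l.+1.
  by move=> lt; apply: b_mono; rewrite !inordK // ltnW.
have M_homog' (i : 'I_t.+1) (j : 'I_t.+2) : int_homog (b' j - a' i) (M i j).
  by rewrite aE bE; have [] := M_homog i j.
have hpE := determinantal_h_polynomial I_max t_gt0 M_homog' b_gt_a b_homo I_ht hpP.
split=> [pure i1 i2|a_const]; last first.
  by rewrite hpE; apply: pure_O_sequence_h_formula => // l _; apply: a_const.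
pose E (j : 'I_t.+2) := minor_degree t.+1 a' b' j.
pose C (l : 'I_t.+1) := syzygy_degree t.+1 a' b' l.
have CE l j : (C l)%:Z = (E j)%:Z + (b j - a l).
  by rewrite -aE -bE; apply: syzygy_degreeE => //; rewrite -ltnS.
have [t0|t1] := posnP t.
  by congr a; apply: val_inj; case: i1 i2 => [x lx] [y ly] /=; lia.
have E_gt1 j : (1 < E j)%N.
  by apply: leq_trans (minor_degree_ge b_gt_a b_homo _); rewrite ?ltnS // -ltnS.
have C_gt1 l : (1 < C l)%N.
  have lt_l : (l < t.+2)%N by apply: leq_trans (ltn_ord l) _.
  have := diag l (inord l); rewrite inordK // => /(_ erefl).
  have := CE l (inord l); have := E_gt1 (inord l); lia.
have EC j l : E j != C l.
  by have := CE l j; have := ba_neq l j; lia.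
have num : resolution_numerator E C = (1 - 'X) ^+ 2 * hp.
  by rewrite hpE; apply: resolution_numeratorE.
have C_eq l := syzygy_degree_of_pure num E_gt1 C_gt1 EC l pure.
(* C_l = E_0 + b_0 - a_l for every row l, so a common value of the C_l determines a_l. *)
have := CE i1 ord0; have := CE i2 ord0; rewrite !C_eq => e2.
by rewrite {1}e2 => /addrI /addrI /oppr_inj.
Qed.

Theorem proposition3p5 (k : fieldType) (n t : nat)
    (A : 'M[int]_(t, t + 2.-1)) (I : {mpoly k[n.+1]} -> Prop) (h : seq int)
    (k_infinite : infinite_type k)
    (I_std_det : @standard_determinantal k n t 2 A I)
    (A_neq0 : forall i j, A i j != 0)
    (h_vec : is_h_vector I h) :
  pure_O_sequence h <-> (forall i1 i2, row i1 A = row i2 A).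
Proof.
have [hp hpP ->] := h_vec.
have [t_gt0 _ [I_ht _] [M [a [b [M_homog I_max eA [_ b_mono] diag]]]]] := I_std_det.
have AE i j : A i j = b j - a i by rewrite eA mxE.
rewrite (pure_O_sequence_determinantal (addn1 t) t_gt0 M_homog I_max b_mono _ _ I_ht hpP).
- split=> [a_const i1 i2|rows i1 i2].
    by apply/rowP => j; rewrite !mxE !AE (a_const i1 i2).
  have /rowP /(_ (lshift 1 i1)) := rows i1 i2; rewrite !mxE !AE.
  by move/addrI/oppr_inj.
- move=> i j eij; rewrite -subr_gt0 -AE.
  by have -> : j = lshift 1 i by apply: val_inj; rewrite /= -eij.
- by move=> i j; rewrite -subr_eq0 -AE.
Qed.
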